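(* Let $1<p<\infty$, $0<q<p-1$, $0<\alpha<n/p$, and let $\sigma$ be a nonnegative locally finite Borel measure on $\mathbb{R}^n$. Suppose there is $\kappa>0$ such that $$\mathbf{W}_{\alpha,p}\Big(\big(\mathbf{W}_{\alpha,p}\sigma\big)^{\frac{(p-1)q}{p-1-q}}d\sigma\Big)\le\kappa\Big(\mathbf{W}_{\alpha,p}\sigma+\big(\mathbf{W}_{\alpha,p}\sigma\big)^{\frac{p-1}{p-1-q}}\Big)<\infty\quad\text{a.e.}\qquad(\dagger)$$ Then there exists a solution $u\ge0$, $u\in L^q_{\rm loc}(\mathbb{R}^n,d\sigma)$, of $u=\mathbf{W}_{\alpha,p}(u^q d\sigma)$ in $\mathbb{R}^n$ such that $$c^{-1}\big(\mathbf{W}_{\alpha,p}\sigma\big)^{\frac{p-1}{p-1-q}}\le u\le c\Big(\mathbf{W}_{\alpha,p}\sigma+\big(\mathbf{W}_{\alpha,p}\sigma\big)^{\frac{p-1}{p-1-q}}\Big)\qquad(\ddagger)$$ with a constant $c>0$ depending only on $\alpha,n,p,q,\kappa$. Conversely, suppose $u\not\equiv0$ is a nonnegative function, finite a.e., with $u\ge\mathbf{W}_{\alpha,p}(u^qd\sigma)$ in $\mathbb{R}^n$ (a supersolution), and $u$ satisfies $(\ddagger)$ with some constant $c>0$. Then $(\dagger)$ holds with $\kappa=\kappa(p,q,c)$.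
   Context: $\mathbf{W}_{\alpha,p}\mu(x)=\int_0^\infty\big(\mu(B(x,t))/t^{n-\alpha p}\big)^{\frac1{p-1}}\frac{dt}{t}$ is the Wolff potential of a nonnegative measure $\mu$; $f\,d\sigma$ denotes the measure with density $f\ge0$ w.r.t. $\sigma$. *)

(* Defs.v *)
From HB Require Import structures.
From mathcomp Require Import all_boot all_order all_algebra.
From mathcomp Require Import all_classical all_reals all_analysis measurable_realfun.
Set Implicit Arguments. Unset Strict Implicit. Unset Printing Implicit Defensive.
Import Order.TTheory GRing.Theory Num.Theory.
Import numFieldNormedType.Exports.
Local Open Scope classical_set_scope.
Local Open Scope ring_scope.

(* R^n as row vectors, equipped with the Borel sigma-algebra generated by
   the open sets of its (product = Euclidean) topology. *)
Definition Rn (R : realType) (n : nat) : Type := 'rV[R]_n.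

Section RnMeasurable.
Variables (R : realType) (n : nat).
HB.instance Definition _ := Pointed.on (Rn R n).
HB.instance Definition _ := @isMeasurable.Build (sigma_display (@open 'rV[R]_n))
  (Rn R n) <<s (@open 'rV[R]_n) >>
  (@sigma_algebra0 _ setT _) (@sigma_algebraC _ _)
  (@sigma_algebra_bigcup _ setT _).
End RnMeasurable.

Definition enorm (R : realType) (n : nat) (x : 'rV[R]_n) : R :=
  Num.sqrt (\sum_(i < n) (x ord0 i) ^+ 2).

Definition eball (R : realType) (n : nat) (x : Rn R n) (t : R) : set (Rn R n) :=
  [set y | enorm (y - x : 'rV[R]_n) < t].

Definition box (R : realType) (n : nat) (a b : 'rV[R]_n) : set (Rn R n) :=
  [set y | forall i : 'I_n, a ord0 i <= y ord0 i <= b ord0 i].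

Definition box_vol (R : realType) (n : nat) (a b : 'rV[R]_n) : R :=
  \prod_(i < n) (b ord0 i - a ord0 i).

Definition lebesgue_null (R : realType) (n : nat) (A : set (Rn R n)) : Prop :=
  forall eps : R, 0 < eps ->
  exists a b : nat -> 'rV[R]_n,
    (forall k (i : 'I_n), a k ord0 i <= b k ord0 i) /\
    A `<=` \bigcup_k box (a k) (b k) /\
    (\sum_(k <oo) (box_vol (a k) (b k))%:E <= eps%:E)%E.

Definition ae_leb (R : realType) (n : nat) (P : Rn R n -> Prop) : Prop :=
  lebesgue_null [set x | ~ P x].

(* Wolff potential of a (nonnegative) set function nu (only its values on
   balls matter):
   W_{alpha,p} nu (x) = int_0^oo (nu(B(x,t)) / t^(n - alpha p))^(1/(p-1)) dt/t *)
Definition wolff (R : realType) (n : nat) (alpha p : R)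
    (nu : set (Rn R n) -> \bar R) (x : Rn R n) : \bar R :=
  (\int[@lebesgue_measure R]_(t in `]0%R, +oo[)
     (poweR (nu (eball x t) * (powR t (alpha * p - n%:R))%:E) (1 / (p - 1))
      * (t^-1)%:E))%E.

Definition dens_measure (R : realType) (n : nat)
    (f : Rn R n -> \bar R) (sigma : set (Rn R n) -> \bar R)
    : set (Rn R n) -> \bar R :=
  fun A => (\int[sigma]_(y in A) f y)%E.

Definition locally_finite_measure (R : realType) (n : nat)
    (sigma : set (Rn R n) -> \bar R) : Prop :=
  forall (x : Rn R n) (r : R), (sigma (eball x r) < +oo)%E.

(* Main.v *)
(** Write [w = W sigma], [s = 1/(p-1)], [g = (p-1)/(p-1-q)] and [r = g q], so
    that [r s + 1 = g]. The proof rests on three facts valid at every point.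
    (i) [W (w^r dsigma) >= K w^(r s + 1) = K w^g]: split the radial integral
    defining [w x] into two halves of equal mass; on the inner half, [w] is
    bounded below on the ball [B(x,t)] by a multiple of the outer half.
    (ii) Potentials are lower semicontinuous.
    (iii) Arbitrarily close to [x] and outside a given null set there is a [y]
    with [w y <= C w x]: choose [y] uniformly in a small cube near [x]; in
    expectation [sigma (B(y,t))] is at most [C (t/d)^n sigma (B(x,C d))].
    By (ii) and (iii) the almost-everywhere inequality (dagger) holds everywhere
    with a larger constant. The monotone iteration [u_0 = c0 w^g],
    [u_(k+1) = W (u_k^q dsigma)] is then increasing by (i) and, since
    [q s < 1], stays below [c1 (w + w^g)]; its supremum is the solution. The
    converse follows from the lower bound on [u] by monotonicity of [W]. *)
Require Import Defs.
From HB Require Import structures.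
From mathcomp Require Import all_boot all_order all_algebra.
From mathcomp Require Import all_classical all_reals all_analysis measurable_realfun.
From mathcomp Require Import lra ring.
Import Order.TTheory GRing.Theory Num.Theory.
Import numFieldNormedType.Exports.
Local Open Scope classical_set_scope.
Local Open Scope ring_scope.
Set Implicit Arguments.
Unset Strict Implicit.
Unset Printing Implicit Defensive.

(** * Extended nonnegative reals and integrals *)

Section ereal_facts.
Context {R : realType}.
Implicit Types (x y : \bar R) (s : R) (u : nat -> \bar R).
Local Open Scope ereal_scope.

(** The measure [sigma] may be singular and charge the Lebesgue null set left out by (dagger),
    whereas the equation is wanted at every point and integrates against [sigma]; so the bound must
    first be made to hold everywhere. Lower semicontinuity controls the left side at [x] by values
    at nearby points, but [w] on the right could be much larger there: hence the need for a point
    [y] with [w y <= C w x]. A random [y] does this, since a null set is hit with small probability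
    and Fubini bounds the mean mass of [B(y,t)]. Asking for all dyadic radii at once costs a factor
    [lam^-k] at scale [k]; the decay [2^(- alpha p k)] left in the integrand pays for it because
    [alpha > 0]. As [T f = W (f^q dsigma)] satisfies [T (c f) = c^(q s) T f] with [q s < 1], [c0] is
    the fixed point of [c |-> c^(q s) K], and [c1] dominates the one of the upper bound. Local
    integrability of [u^q] comes from the equation itself: a potential finite at one point forces
    finite mass on every ball. *)

Lemma le_poweR x y s : (0 <= s)%R -> 0 <= x -> x <= y -> poweR x s <= poweR y s.
Proof.
move=> s0 x0 xy; apply: gt0_ler_poweR => //; rewrite in_itv/= leey andbT //.
exact: le_trans xy.
Qed.

Lemma ler_npowR (b t r : R) : (b <= 0)%R -> (0 < t)%R -> (t <= r)%R ->
  (r `^ b <= t `^ b)%R.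
Proof.
move=> b0 t0 tr; have r0 : (0 < r)%R := lt_le_trans t0 tr.
have [c c0 ->] : exists2 c, (0 <= c)%R & b = (- c)%R by exists (- b)%R; rewrite ?opprK ?oppr_ge0.
rewrite !powRN lef_pV2 ?posrE ?powR_gt0//.
by apply: ge0_ler_powR; rewrite ?nnegrE ?(ltW t0) ?(ltW r0).
Qed.

Lemma poweRK x s : s != 0%R -> 0 <= x -> poweR (poweR x s) s^-1 = x.
Proof. by move=> s0 x0; rewrite -poweRrM mulfV// poweRe1. Qed.

Lemma poweRVK x s : s != 0%R -> 0 <= x -> poweR (poweR x s^-1) s = x.
Proof. by move=> s0 x0; rewrite -poweRrM mulVf// poweRe1. Qed.

Lemma ereal_supM_seq u (c : R) : (0 <= c)%R ->
  ereal_sup (range (fun k => c%:E * u k)) = c%:E * ereal_sup (range u).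
Proof.
move=> c0; rewrite -ereal_supZl//; last by apply/set0P; exists (u 0%N); exists 0%N.
by rewrite -image_comp.
Qed.

Lemma ereal_sup_ge0 u : (forall k, 0 <= u k) -> 0 <= ereal_sup (range u).
Proof. by move=> u0; apply: le_trans (u0 0%N) _; apply: ereal_sup_ubound; exists 0%N. Qed.

(** Applying the inverse power [s^-1] to an upper bound of the powers bounds every [u k]; this
    avoids limits and covers infinite values. *)
Lemma poweR_sup u s : (0 < s)%R -> (forall k, 0 <= u k) ->
  poweR (ereal_sup (range u)) s = ereal_sup (range (fun k => poweR (u k) s)).
Proof.
move=> s0 u0; apply/eqP; rewrite eq_le; apply/andP; split; last first.
  apply: ge_ereal_sup => _ [k _ <-]; apply: le_poweR => //; first exact: ltW.
  by apply: ereal_sup_ubound; exists k.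
set M := ereal_sup (range (fun k => poweR (u k) s)).
have M0 : 0 <= M by apply: ereal_sup_ge0 => k; exact: poweR_ge0.
have s0' : s != 0%R by rewrite gt_eqF.
rewrite -[leRHS](@poweRVK _ s)//; apply: le_poweR; [exact: ltW|exact: ereal_sup_ge0|].
apply: ge_ereal_sup => _ [k _ <-]; rewrite -[leLHS](@poweRK _ s)//.
apply: le_poweR; rewrite ?poweR_ge0 ?invr_ge0 ?(ltW s0)//.
by apply: ereal_sup_ubound; exists k.
Qed.

(** The larger term is at least half of the sum. The constant is not sharp but serves concave and
    convex powers alike: [1/(p-1)] and [q] may lie on either side of 1. *)
Lemma poweRD_le x y s : (0 <= s)%R -> 0 <= x -> 0 <= y ->
  poweR (x + y) s <= (2 `^ s)%:E * (poweR x s + poweR y s).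
Proof.
move=> s0; wlog xy : x y / x <= y => [hw|] x0 y0.
  have [/hw->//|/ltW yx] := leP x y.
  by rewrite addeC [X in _ * X]addeC; apply: hw.
apply: (@le_trans _ _ (poweR (2%:E * y) s)).
  apply: le_poweR => //; first exact: adde_ge0.
  by rewrite mule_natl mule2n leeD2r.
rewrite poweRM ?lee_fin//= lee_wpmul2l ?lee_fin ?powR_ge0//.
by rewrite leeDr// poweR_ge0.
Qed.

Lemma integral_sup d (T : measurableType d) (mu : {measure set T -> \bar R})
    (D : set T) (f : nat -> T -> \bar R) : measurable D ->
  (forall k, measurable_fun D (f k)) -> (forall k z, D z -> 0 <= f k z) ->
  (forall z, D z -> {homo f^~ z : j k / (j <= k)%N >-> j <= k}) ->
  \int[mu]_(z in D) ereal_sup (range (f^~ z)) =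
  ereal_sup (range (fun k => \int[mu]_(z in D) f k z)).
Proof.
move=> mD mf f0 ndf.
have /cvg_lim lim1 := cvg_monotone_convergence (mu := mu) mD mf f0 ndf.
have nd : nondecreasing_seq (fun k => \int[mu]_(z in D) f k z).
  by move=> j k jk; apply: ge0_le_integral => // z Dx; [exact: f0|exact: ndf].
have /cvg_lim <- // := ereal_nondecreasing_cvgn nd.
rewrite lim1//; apply: eq_integral => z /[!inE] Dx.
by have /cvg_lim -> // := ereal_nondecreasing_cvgn (ndf z Dx).
Qed.

Lemma nondecreasing_emeasurable (m : measurableTypeR R -> \bar R) :
  {homo m : t r / (t <= r)%R >-> t <= r} -> measurable_fun [set: measurableTypeR R] m.
Proof.
move=> ndm; apply: (measurability _ (ErealGenOInfty.measurableE R)).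
move=> /= _ [_ [a ->]] <-; rewrite setTI.
apply: is_interval_measurable => s t /=; rewrite !in_itv/= !andbT => ms mt u /andP[su ut].
by rewrite in_itv/= andbT (lt_le_trans ms)// ndm.
Qed.

(** The pushforward of Lebesgue measure under [t |-> c t], multiplied by [c], has the right value on
    intervals []a, b]], so uniqueness identifies it with Lebesgue measure. *)
Lemma integral_scale (f : measurableTypeR R -> \bar R) (c : R) : (0 < c)%R ->
  measurable_fun (T := measurableTypeR R) `]0%R, +oo[ f -> (forall t, (0 < t)%R -> 0 <= f t) ->
  \int[@lebesgue_measure R]_(t in `]0%R, +oo[) f t =
  c%:E * \int[@lebesgue_measure R]_(t in `]0%R, +oo[) f (c * t)%R.
Proof.
move=> c0 mf f0.
pose phi : measurableTypeR R -> measurableTypeR R := fun t => (c * t)%R.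
have mphi : measurable_fun [set: measurableTypeR R] phi.
  by apply: measurable_funM => //; exact: measurable_id.
pose cn : {nonneg R} := NngNum (ltW c0).
have mfT : measurable_fun (T := measurableTypeR R) `]0%R, +oo[ f by [].
have [nu nuE] : exists nu : {measure set (measurableTypeR R) -> \bar R},
    nu = pushforward (@lebesgue_measure R) phi :> (set _ -> \bar R).
  by unshelve eexists (pushforward (@lebesgue_measure R) phi).
transitivity (\int[mscale cn nu]_(t in `]0%R, +oo[) f t).
  apply: eq_measure_integral => A mA _.
  apply: lebesgue_measure_unique => //.
  move=> _ [[a b] _ <-]; rewrite /= /mscale/= nuE /pushforward.
  have -> : phi @^-1` `]a, b] = `](c^-1 * a)%R, (c^-1 * b)%R]%classic.
    by apply/seteqP; split => t /=; rewrite !in_itv/= ltr_pdivrMl// ler_pdivlMl.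
  rewrite !lebesgue_measure_itv/= !lte_fin ltr_pM2l ?invr_gt0//.
  case: ifPn => _; last by rewrite mule0.
  by rewrite -EFinD -EFinM -mulrBr mulrA mulfV ?gt_eqF// mul1r.
rewrite ge0_integral_mscale//; last by move=> t /=; rewrite in_itv/= andbT; exact: f0.
congr (_ * _); rewrite nuE.
rewrite ge0_integral_pushforward//; last first.
  by move=> t; rewrite inE/= in_itv/= andbT; exact: f0.
have -> // : phi @^-1` `]0%R, +oo[ = `]0%R, +oo[%classic.
by apply/seteqP; split => t /=; rewrite !in_itv/= !andbT /phi pmulr_rgt0.
Qed.

End ereal_facts.

(** * The radial integral behind the Wolff potential *)

Section potential.
Context {R : realType} (b s : R).
Hypothesis s0 : 0 < s.
Local Open Scope ereal_scope.
Implicit Types (m : R -> \bar R) (c t r : R).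

(** Radial form of the Wolff integrand: [m t] stands for [nu (B(x,t))], [b] for [alpha p - n] and
    [s] for [1/(p-1)]. Fixing the centre makes the estimates one-dimensional. *)
Definition kern m t : \bar R := poweR (m t * (powR t b)%:E) s * (t^-1)%:E.

Definition pot m : \bar R := \int[@lebesgue_measure R]_(t in `]0%R, +oo[) kern m t.

(** Monotonicity is asked on the whole line, so that dilated and shifted mass functions stay in the
    class and measurability is automatic; balls of radius at most 0 are empty. *)
Definition profile m :=
  (forall t, 0 <= m t) /\ {homo m : t r / (t <= r)%R >-> t <= r}.

Lemma kern_ge0 m t : (0 < t)%R -> 0 <= kern m t.
Proof. by move=> t0; rewrite mule_ge0 ?poweR_ge0// lee_fin invr_ge0 ltW. Qed.

Lemma kern_le m1 m2 t : (0 < t)%R -> 0 <= m1 t -> m1 t <= m2 t ->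
  kern m1 t <= kern m2 t.
Proof.
move=> t0 m0 m12; apply: lee_wpmul2r; first by rewrite lee_fin invr_ge0 ltW.
apply: le_poweR; first exact: ltW.
- by rewrite mule_ge0// lee_fin powR_ge0.
- by apply: lee_wpmul2r => //; rewrite lee_fin powR_ge0.
Qed.

Lemma measurable_kern m : measurable_fun [set: measurableTypeR R] m ->
  measurable_fun (T := measurableTypeR R) `]0%R, +oo[ (kern m).
Proof.
move=> mm; have mpow c : measurable_fun [set: measurableTypeR R] (fun t => (t `^ c)%:E).
  by apply/measurable_EFinP; exact: measurable_powR.
apply: emeasurable_funM.
  apply: measurable_funTS.
  apply: (@measurableT_comp _ _ _ _ _ _ (fun x => poweR x s)).
    exact: measurable_poweR.
  by apply: emeasurable_funM => //; exact: mpow.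
apply: (@eq_measurable_fun _ _ _ _ _ (fun t => (t `^ (-1))%:E)).
  by move=> t; rewrite inE/= in_itv/= andbT => t0; rewrite powR_inv1// ltW.
by apply: measurable_funTS; exact: mpow.
Qed.

Lemma pot_ge0 m : 0 <= pot m.
Proof. by apply: integral_ge0 => t /=; rewrite in_itv/= andbT; exact: kern_ge0. Qed.

Lemma pot_le_meas m1 m2 :
  measurable_fun [set: measurableTypeR R] m1 -> measurable_fun [set: measurableTypeR R] m2 ->
  (forall t, (0 < t)%R -> 0 <= m1 t <= m2 t) -> pot m1 <= pot m2.
Proof.
move=> mm1 mm2 m12; apply: ge0_le_integral => //.
- by move=> t /=; rewrite in_itv/= andbT; exact: kern_ge0.
- exact: measurable_kern.
- exact: measurable_kern.
- move=> t /=; rewrite in_itv/= andbT => t0.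
  by apply: kern_le => //; have /andP[] := m12 _ t0.
Qed.

Lemma profile_measurable m : profile m -> measurable_fun [set: measurableTypeR R] m.
Proof. by case=> _; exact: nondecreasing_emeasurable. Qed.

Lemma pot_le m1 m2 : profile m1 -> profile m2 ->
  (forall t, (0 < t)%R -> m1 t <= m2 t) -> pot m1 <= pot m2.
Proof.
move=> p1 p2 m12; apply: pot_le_meas; try exact: profile_measurable.
by move=> t t0; rewrite p1.1 m12.
Qed.

Lemma profile_add m1 m2 : profile m1 -> profile m2 -> profile (fun t => m1 t + m2 t).
Proof.
move=> [m0 ndm] [m0' ndm']; split=> [t|t r tr]; first by rewrite adde_ge0.
by apply: leeD; [exact: ndm|exact: ndm'].
Qed.

Lemma profile_scale c m : (0 <= c)%R -> profile m -> profile (fun t => m (c * t)%R).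
Proof. by move=> c0 [m0 ndm]; split=> [t//|t r tr]; apply: ndm; rewrite ler_wpM2l. Qed.

Lemma profile_shift c m : profile m -> profile (fun t => m (t - c)%R).
Proof. by move=> [m0 ndm]; split=> [t//|t r tr]; apply: ndm; rewrite lerD2r. Qed.

Lemma pot_cmul c m : (0 <= c)%R -> profile m ->
  pot (fun t => c%:E * m t) = (c `^ s)%:E * pot m.
Proof.
move=> c0 pm; rewrite /pot -ge0_integralZl//.
- apply: eq_integral => t; rewrite inE/= in_itv/= andbT => t0.
  have m0 : 0 <= m t * (t `^ b)%:E by rewrite mule_ge0 ?pm.1// lee_fin powR_ge0.
  by rewrite /kern -(muleA c%:E) (@poweRM _ c%:E) ?lee_fin// muleA.
- by apply: measurable_kern; exact: profile_measurable.
- by move=> t /=; rewrite in_itv/= andbT; exact: kern_ge0.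
- by rewrite lee_fin powR_ge0.
Qed.

Lemma pot_add m1 m2 : profile m1 -> profile m2 ->
  pot (fun t => m1 t + m2 t) <= (2 `^ s)%:E * (pot m1 + pot m2).
Proof.
move=> p1 p2.
have k0 m t : `]0%R, +oo[%classic t -> 0 <= kern m t.
  by rewrite /= in_itv/= andbT; exact: kern_ge0.
have mk m : profile m -> measurable_fun (T := measurableTypeR R) `]0%R, +oo[ (kern m).
  by move=> pm; by apply: measurable_kern; exact: profile_measurable.
rewrite -ge0_integralD//; [|exact: k0|exact: mk|exact: k0|exact: mk].
have mk12 : measurable_fun (T := measurableTypeR R) `]0%R, +oo[ (fun t => kern m1 t + kern m2 t).
  by apply: emeasurable_funD; exact: mk.
rewrite -ge0_integralZl//; last by move=> t Dt; rewrite adde_ge0// k0.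
apply: ge0_le_integral => //.
- exact: k0.
- by apply: mk; exact: profile_add.
- exact: measurable_funeM.
move=> t /=; rewrite in_itv/= andbT => t0.
have h m : profile m -> 0 <= m t * (t `^ b)%:E.
  by move=> pm; rewrite mule_ge0 ?pm.1// lee_fin powR_ge0.
rewrite /kern /= -muleDl ?ge0_adde_def ?inE ?poweR_ge0// muleA.
apply: lee_wpmul2r; first by rewrite lee_fin invr_ge0 ltW.
rewrite ge0_muleDl ?p1.1 ?p2.1//; apply: poweRD_le; rewrite ?h//; exact: ltW.
Qed.

(** The substitution [t -> c t] leaves [dt/t] invariant; only the weight [t^b], raised to the power
    [s], produces a factor. *)
Lemma pot_scale c m : (0 < c)%R -> profile m ->
  pot m = (c `^ (b * s))%:E * pot (fun t => m (c * t)%R).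
Proof.
move=> c0 pm; rewrite /pot (integral_scale c0); last 2 first.
- by apply: measurable_kern; exact: profile_measurable.
- exact: kern_ge0.
have pm' := profile_scale (ltW c0) pm.
rewrite -!ge0_integralZl//.
- apply: eq_integral => t; rewrite inE/= in_itv/= andbT => t0.
  rewrite /kern /= powRM ?ltW// EFinM invfM EFinM powRrM -poweR_EFin.
  rewrite [X in poweR X s](_ : _ = (c `^ b)%:E * (m (c * t)%R * (t `^ b)%:E)); last first.
    by rewrite muleCA.
  rewrite (@poweRM _ (c `^ b)%:E) ?lee_fin ?powR_ge0 ?mule_ge0 ?pm.1 ?lee_fin ?powR_ge0//.
  set P := poweR _ _; set C := poweR _ _.
  rewrite [in LHS]muleC -!muleA.
  rewrite -[P]/(((c `^ b) `^ s)%:E); congr (_ * (_ * _)).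
  by rewrite -!EFinM; congr (_%:E); rewrite mulrCA mulVf ?mulr1// gt_eqF.
- by apply: measurable_kern; exact: profile_measurable.
- by move=> t /=; rewrite in_itv/= andbT; exact: kern_ge0.
- by rewrite lee_fin powR_ge0.
- apply: (@measurable_comp _ _ _ (measurableTypeR R) (measurableTypeR R) _
    `]0%R, +oo[%classic (kern m) _ (fun t => c * t)%R).
  + exact: measurable_itv.
  + by move=> _ /= [t + <-]; rewrite !in_itv/= !andbT => t0; rewrite mulr_gt0.
  + exact: measurable_kern (profile_measurable pm).
  + by apply: measurable_funTS; apply: measurable_funM => //; exact: measurable_id.
- by move=> t /=; rewrite in_itv/= andbT => t0; apply: kern_ge0; rewrite mulr_gt0.
- by rewrite lee_fin ltW.
Qed.

Lemma pot_sup (m : nat -> R -> \bar R) : (forall k, profile (m k)) ->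
  (forall t j k, (j <= k)%N -> m j t <= m k t) ->
  pot (fun t => ereal_sup (range (m^~ t))) = ereal_sup (range (fun k => pot (m k))).
Proof.
move=> pm ndm; rewrite /pot -integral_sup//; first last.
- move=> t /=; rewrite in_itv/= andbT => t0 j k jk.
  by apply: kern_le => //; [exact: (pm j).1|exact: ndm].
- by move=> k t /=; rewrite in_itv/= andbT; exact: kern_ge0.
- by move=> k; by apply: measurable_kern; exact: profile_measurable.
apply: eq_integral => t; rewrite inE/= in_itv/= andbT => t0.
rewrite /kern.
have -> : ereal_sup (range (m^~ t)) * (t `^ b)%:E =
    ereal_sup (range (fun k => m k t * (t `^ b)%:E)).
  rewrite muleC -ereal_supM_seq ?powR_ge0//.
  by congr (ereal_sup _); apply: eq_imagel => k _; rewrite muleC.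
rewrite poweR_sup//; last by move=> k; rewrite mule_ge0 ?(pm k).1// lee_fin powR_ge0.
rewrite muleC -ereal_supM_seq ?invr_ge0 ?ltW//.
by congr (ereal_sup _); apply: eq_imagel => k _; rewrite muleC.
Qed.

(** On []T, 2T]] the mass is at least [m T], while [t^b >= (2T)^b] and [1/t >= 1/(2T)]; the interval
    has length [T], whence the factor 1/2. *)
Lemma pot_ge m T : (0 < T)%R -> (b <= 0)%R -> profile m ->
  poweR (m T * ((2 * T) `^ b)%:E) s * 2^-1%:E <= pot m.
Proof.
move=> T0 b0 pm.
set q := poweR _ s.
have q0 : 0 <= q by exact: poweR_ge0.
apply: (@le_trans _ _ (\int[@lebesgue_measure R]_(t in `]T, (2 * T)%R]) (q * ((2 * T)^-1)%:E))).
  rewrite integral_cst//= lebesgue_measure_itv/= lte_fin ltr_pMl// ltr1n.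
  rewrite -EFinD -muleA -EFinM lee_wpmul2l// lee_fin.
  by rewrite le_eqVlt; apply/orP; left; apply/eqP; field; rewrite gt_eqF.
have mk : measurable_fun (T := measurableTypeR R) `]0%R, +oo[ (kern m).
  by apply: measurable_kern; exact: profile_measurable.
have sub : `]T, (2 * T)%R] `<=` `]0%R, +oo[%classic.
  by move=> t /=; rewrite !in_itv/= andbT => /andP[Tt _]; exact: lt_trans Tt.
apply: (@le_trans _ _ (\int[@lebesgue_measure R]_(t in `]T, (2 * T)%R]) kern m t)); last first.
  by apply: ge0_subset_integral => // t /=; rewrite in_itv/= andbT; exact: kern_ge0.
apply: ge0_le_integral => //.
- by move=> t _; rewrite mule_ge0// lee_fin invr_ge0 mulr_ge0// ltW.
- exact: measurable_funS mk.
move=> t /=; rewrite in_itv/= => /andP[Tt t2].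
have t0 : (0 < t)%R by exact: lt_trans Tt.
apply: lee_pmul => //; first by rewrite lee_fin invr_ge0 mulr_ge0// ltW.
  apply: le_poweR; first exact: ltW.
  - by rewrite mule_ge0 ?pm.1// lee_fin powR_ge0.
  - apply: lee_pmul; rewrite ?pm.1 ?lee_fin ?powR_ge0//; first by apply: pm.2; exact: ltW.
    by apply: ler_npowR.
by rewrite lee_fin lef_pV2 ?posrE ?mulr_gt0.
Qed.

(** An infinite mass at a positive radius would make the lower bound of [pot_ge] infinite; [|T| + 1]
    supplies such a radius above [T]. *)
Lemma pot_lty m T : (b <= 0)%R -> profile m -> pot m < +oo -> m T < +oo.
Proof.
move=> b0 pm h; set T' := (`|T| + 1)%R.
have T'0 : (0 < T')%R by rewrite ltr_pwDr.
apply: (@le_lt_trans _ _ (m T')).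
  by apply: pm.2; rewrite (le_trans (ler_norm _))// lerDl.
rewrite ltey; apply/eqP => mT.
have := le_lt_trans (pot_ge T'0 b0 pm) h.
have c0 : (0 < (2 * T') `^ b)%R by rewrite powR_gt0// mulr_gt0.
by rewrite mT gt0_mulye ?lte_fin// poweRyr ?gt_eqF// gt0_mulye ?lte_fin// ltxx.
Qed.

End potential.

(** * Euclidean balls *)

Lemma continuous_sum (T : topologicalType) (R : realType) (I : finType)
    (f : I -> T -> R) :
  (forall x i, {for x, continuous (f i)}) -> continuous (fun x => \sum_i f i x).
Proof.
move=> cf x; rewrite /prop_for /continuous_at; elim: (index_enum I) => [|i r IH].
  by under eq_fun do rewrite big_nil; rewrite big_nil; exact: cvg_cst.
by under eq_fun do rewrite big_cons; rewrite big_cons; apply: cvgD; [exact: cf|exact: IH].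
Qed.

Section euclidean.
Context {R : realType} {n : nat}.
Implicit Types x y z : 'rV[R]_n.

Lemma sumsq_ge0 x : 0 <= \sum_(i < n) x ord0 i ^+ 2.
Proof. by apply: sumr_ge0 => i _; exact: sqr_ge0. Qed.

Lemma enorm_ge0 x : 0 <= enorm x. Proof. exact: sqrtr_ge0. Qed.

Lemma sqr_enorm x : enorm x ^+ 2 = \sum_(i < n) x ord0 i ^+ 2.
Proof. by rewrite /enorm sqr_sqrtr// sumsq_ge0. Qed.

Lemma coord_le_enorm x (i : 'I_n) : `|x ord0 i| <= enorm x.
Proof.
rewrite -sqrtr_sqr; apply: ler_wsqrtr.
by rewrite (bigD1 i)//= lerDl sumr_ge0// => j _; exact: sqr_ge0.
Qed.

Lemma enorm0 : enorm (0 : 'rV[R]_n) = 0.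
Proof. by rewrite /enorm big1 ?sqrtr0// => i _; rewrite mxE expr0n. Qed.

Lemma enormN x : enorm (- x) = enorm x.
Proof. by rewrite /enorm; congr Num.sqrt; apply: eq_bigr => i _; rewrite mxE sqrrN. Qed.

Lemma enormB x y : enorm (x - y) = enorm (y - x).
Proof. by rewrite -enormN opprB. Qed.

(** Cauchy-Schwarz: expand the sum of the squares of [a y_i - b x_i], with [a], [b] the two norms,
    and divide by [a b]; hence the separate case [a b = 0]. *)
Lemma enorm_dot_le x y : \sum_(i < n) x ord0 i * y ord0 i <= enorm x * enorm y.
Proof.
set B := \sum_(i < n) _; set a := enorm x; set b := enorm y.
have a0 : 0 <= a := enorm_ge0 x.
have b0 : 0 <= b := enorm_ge0 y.
have [ab0|ab0] := eqVneq (a * b) 0.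
  rewrite ab0 /B big1// => i _.
  have := coord_le_enorm x i; have := coord_le_enorm y i; rewrite -/a -/b.
  move/eqP : ab0; rewrite mulf_eq0 => /orP[] /eqP ->; rewrite !normr_le0.
    by move=> _ /eqP ->; rewrite mul0r.
  by move=> /eqP -> _; rewrite mulr0.
have abp : 0 < a * b by rewrite lt_neqAle eq_sym ab0 mulr_ge0.
rewrite -(ler_pM2l abp) -subr_ge0.
have -> : a * b * (a * b) - a * b * B =
    2^-1 * \sum_(i < n) (a * y ord0 i - b * x ord0 i) ^+ 2.
  have -> : \sum_(i < n) (a * y ord0 i - b * x ord0 i) ^+ 2 =
      a ^+ 2 * (\sum_(i < n) y ord0 i ^+ 2) + b ^+ 2 * (\sum_(i < n) x ord0 i ^+ 2)
      - 2 * (a * b) * B.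
    rewrite /B !mulr_sumr -big_split/= -sumrB; apply: eq_bigr => i _; ring.
  rewrite -!sqr_enorm -/a -/b; by field.
by rewrite mulr_ge0// sumr_ge0// => i _; exact: sqr_ge0.
Qed.

Lemma enormD x y : enorm (x + y) <= enorm x + enorm y.
Proof.
rewrite -(ler_pXn2r (ltn0Sn 1)) ?nnegrE ?addr_ge0 ?enorm_ge0// sqrrD !sqr_enorm.
have -> : \sum_(i < n) (x + y) ord0 i ^+ 2 = \sum_(i < n) x ord0 i ^+ 2 +
    (\sum_(i < n) x ord0 i * y ord0 i) *+ 2 + \sum_(i < n) y ord0 i ^+ 2.
  by rewrite -sumrMnl -!big_split/=; apply: eq_bigr => i _; rewrite mxE sqrrD.
by rewrite lerD2r lerD2l lerMn2r/= enorm_dot_le.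
Qed.

Lemma enorm_triangle x y z : enorm (x - z) <= enorm (x - y) + enorm (y - z).
Proof. by rewrite (le_trans _ (enormD _ _))// addrA subrK. Qed.

Lemma enorm_le_coord x (c : R) : 0 <= c -> (forall i, `|x ord0 i| <= c) ->
  enorm x <= n%:R * c.
Proof.
move=> c0 xc; rewrite -(ler_pXn2r (ltn0Sn 1)) ?nnegrE ?mulr_ge0 ?enorm_ge0//.
rewrite sqr_enorm (@le_trans _ _ (\sum_(i < n) c ^+ 2))//.
  by apply: ler_sum => i _; rewrite -real_normK ?num_real// ler_sqr ?nnegrE.
rewrite sumr_const card_ord exprMn -[leLHS]mulr_natl.
apply: ler_wpM2r; first exact: sqr_ge0.
by rewrite -natrX ler_nat -mulnn; case: (n) => // k; rewrite leq_pmulr.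
Qed.

Lemma continuous_enormB x : continuous (fun y : 'rV[R]_n => enorm (y - x)).
Proof.
move=> y; apply: (@continuous_comp _ _ _
  (fun y : 'rV[R]_n => \sum_(i < n) (y - x) ord0 i ^+ 2)); last exact: sqrt_continuous.
apply: continuous_sum => {}y i.
apply: (@continuous_comp _ _ _
  (fun y : 'rV[R]_n => (y - x) ord0 i) (fun t : R => t ^+ 2)); last exact: exprn_continuous.
rewrite (_ : (fun y : 'rV[R]_n => (y - x) ord0 i) = (fun y => y ord0 i - x ord0 i)); last first.
  by apply/funext => z; rewrite !mxE.
apply: (@continuous_comp _ _ _ (fun y : 'rV[R]_n => y ord0 i) (fun t : R => t - x ord0 i)).
  exact: coord_continuous.
by apply: cvgB; [exact: cvg_id|exact: cvg_cst].
Qed.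

Lemma open_eball x (t : R) : open (eball x t : set 'rV[R]_n).
Proof.
rewrite (_ : eball x t = (fun y : 'rV[R]_n => enorm (y - x)) @^-1` [set r | r < t]).
  by apply: open_comp; [move=> y _; exact: continuous_enormB|exact: open_lt].
by apply/seteqP; split.
Qed.

Lemma measurable_open (A : set (Rn R n)) : open (A : set 'rV[R]_n) -> measurable A.
Proof. exact: sub_sigma_algebra. Qed.

Lemma measurable_eball (x : Rn R n) t : measurable (eball x t).
Proof. by apply: measurable_open; exact: open_eball. Qed.

Lemma open_eballP (A : set 'rV[R]_n) :
  (forall x, A x -> exists2 d, 0 < d & eball x d `<=` A) -> open A.
Proof.
move=> h; rewrite openE => x /h[d d0 dA].
apply: (filterS dA); apply: open_nbhs_nbhs; split; first exact: open_eball.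
by rewrite /eball/= subrr enorm0.
Qed.

Lemma subset_eball (x y : Rn R n) (t r : R) : enorm (x - y : 'rV[R]_n) + t <= r ->
  eball x t `<=` eball y r.
Proof.
move=> xy z; rewrite /eball/= => zt.
apply: le_lt_trans (enorm_triangle _ x _) _; rewrite addrC.
by apply: lt_le_trans xy; rewrite ltrD2l.
Qed.

Lemma subset_eballr (x : Rn R n) (t r : R) : t <= r -> eball x t `<=` eball x r.
Proof. by move=> tr; apply: subset_eball; rewrite subrr enorm0 add0r. Qed.


Lemma continuous_measurable_Rn (f : Rn R n -> R) :
  continuous (f : 'rV[R]_n -> R) -> measurable_fun [set: Rn R n] f.
Proof.
move=> cf; apply: (measurability (@RGenOInfty.G R)) => [|/= _ [_] [r] -> <-].
  exact: RGenOInfty.measurableE.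
rewrite setTI; apply: measurable_open.
by apply: open_comp; [move=> y _; exact: cf|exact: interval_open].
Qed.

Lemma measurable_coord (i : 'I_n) :
  measurable_fun [set: Rn R n] (fun y : Rn R n => (y : 'rV[R]_n) ord0 i).
Proof. by apply: continuous_measurable_Rn; exact: coord_continuous. Qed.

(** Superlevel sets are open, hence Borel. Potentials get their measurability from their
    semicontinuity in this way. *)
Lemma lsc_measurable (f : Rn R n -> \bar R) :
  (forall x a, (a < f x)%E -> exists2 d, 0 < d &
    forall y, enorm (y - x : 'rV[R]_n) < d -> (a < f y)%E) ->
  measurable_fun [set: Rn R n] f.
Proof.
move=> h; apply: (measurability _ (ErealGenOInfty.measurableE R)).
move=> /= _ [_ [a ->]] <-; rewrite setTI; apply: measurable_open.
apply: open_eballP => x; rewrite /= in_itv/= andbT => /h[d d0 dP]; exists d => // y yx.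
by rewrite /= in_itv/= andbT; exact: dP.
Qed.

End euclidean.

(** * Measures with density and their potentials *)

Section density.
Context {R : realType} {n : nat} (sigma : {measure set (Rn R n) -> \bar R}).
Local Open Scope ereal_scope.
Implicit Types (f g : Rn R n -> \bar R) (x y : Rn R n) (A : set (Rn R n)).

Definition nnegmeas f := measurable_fun [set: Rn R n] f /\ forall x, 0 <= f x.

Lemma dens_ge0 f A : nnegmeas f -> 0 <= dens_measure f sigma A.
Proof. by move=> [_ f0]; apply: integral_ge0. Qed.

Lemma dens_le f g A : measurable A -> nnegmeas f -> nnegmeas g ->
  (forall x, f x <= g x) -> dens_measure f sigma A <= dens_measure g sigma A.
Proof.
move=> mA [mf f0] [mg g0] fg.
by apply: ge0_le_integral => //; exact: measurable_funTS.
Qed.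

Lemma dens_subset f A B : measurable A -> measurable B -> nnegmeas f -> A `<=` B ->
  dens_measure f sigma A <= dens_measure f sigma B.
Proof.
move=> mA mB [mf f0] AB.
by apply: ge0_subset_integral => //; exact: measurable_funTS.
Qed.

Lemma dens_cmul f A (c : R) : measurable A -> (0 <= c)%R -> nnegmeas f ->
  dens_measure (fun y => c%:E * f y) sigma A = c%:E * dens_measure f sigma A.
Proof.
move=> mA c0 [mf f0]; rewrite /dens_measure ge0_integralZl//.
by exact: measurable_funTS.
Qed.

Lemma dens_add f g A : measurable A -> nnegmeas f -> nnegmeas g ->
  dens_measure (fun y => f y + g y) sigma A =
  dens_measure f sigma A + dens_measure g sigma A.
Proof.
move=> mA [mf f0] [mg g0]; rewrite /dens_measure ge0_integralD//; exact: measurable_funTS.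
Qed.

Lemma dens1 A : measurable A -> dens_measure (fun=> 1) sigma A = sigma A.
Proof. by move=> mA; rewrite /dens_measure integral_cst// mul1e. Qed.

Lemma dens_sup (f : nat -> Rn R n -> \bar R) A : measurable A ->
  (forall k, nnegmeas (f k)) -> (forall x j k, (j <= k)%N -> f j x <= f k x) ->
  dens_measure (fun x => ereal_sup (range (f^~ x))) sigma A =
  ereal_sup (range (fun k => dens_measure (f k) sigma A)).
Proof.
move=> mA f0 ndf; rewrite /dens_measure integral_sup//.
- by move=> k; apply: measurable_funTS; exact: (f0 k).1.
- by move=> k x _; exact: (f0 k).2.
- by move=> x _ j k jk; exact: ndf.
Qed.

Lemma nnegmeas_cst (c : R) : (0 <= c)%R -> nnegmeas (fun=> c%:E).
Proof. by move=> c0; split. Qed.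

Lemma nnegmeas_cmul f (c : R) : (0 <= c)%R -> nnegmeas f -> nnegmeas (fun y => c%:E * f y).
Proof. by move=> c0 [mf f0]; split=> [|y]; [exact: measurable_funeM|rewrite mule_ge0]. Qed.

Lemma nnegmeas_add f g : nnegmeas f -> nnegmeas g -> nnegmeas (fun y => f y + g y).
Proof. by move=> [mf f0] [mg g0]; split=> [|y]; [exact: emeasurable_funD|rewrite adde_ge0]. Qed.

Lemma nnegmeas_poweR f (r : R) : nnegmeas f -> nnegmeas (fun y => poweR (f y) r).
Proof.
move=> [mf f0]; split=> [|y]; last exact: poweR_ge0.
exact: (measurableT_comp (measurable_poweR r) mf).
Qed.

Lemma nnegmeas_sup (f : nat -> Rn R n -> \bar R) : (forall k, nnegmeas (f k)) ->
  nnegmeas (fun x => ereal_sup (range (f^~ x))).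
Proof.
move=> f0; split=> [|x]; last by apply: ereal_sup_ge0 => k; exact: (f0 k).2.
have := @measurable_fun_esups _ _ _ [set: Rn R n] f (fun k => (f0 k).1) 0%N.
by congr measurable_fun; apply/funext => x; rewrite /esups /sdrop; congr ereal_sup;
  apply/seteqP; split => _ [k _ <-]; exists k.
Qed.

Lemma dens_profile f x : nnegmeas f -> profile (fun t => dens_measure f sigma (eball x t)).
Proof.
move=> nf; split=> [t|t r tr]; first exact: dens_ge0.
by apply: dens_subset => //; [exact: measurable_eball..|exact: subset_eballr].
Qed.

(** Exhausting the open ball from inside leaves a margin [1/(k+1)] in the radius, the room in which
    the centre can later move. *)
Lemma dens_eball_sup f x (t : R) : nnegmeas f ->
  dens_measure f sigma (eball x t) =
  ereal_sup (range (fun k : nat => dens_measure f sigma (eball x (t - k.+1%:R^-1)))).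
Proof.
move=> [mf f0].
pose F (k : nat) := eball x (t - k.+1%:R^-1).
have ndF : nondecreasing_seq F.
  move=> j k jk; apply/subsetPset; apply: subset_eballr.
  by rewrite lerD2l lerN2 lef_pV2 ?posrE ?ltr0n// ler_nat ltnS.
have mF k : measurable (F k) by exact: measurable_eball.
have -> : eball x t = \bigcup_k F k.
  apply/seteqP; split=> [y yt|y [k _]]; last first.
    by apply: subset_eballr; rewrite gerBl invr_ge0 ler0n.
  have [k kP] := @ltr_add_invr _ (enorm (y - x : 'rV[R]_n)) t yt.
  by exists k => //; rewrite /F /eball/= ltrBrDr.
have mfF i : measurable_fun (F i) f by exact: measurable_funTS.
have nd := ge0_nondecreasing_set_nondecreasing_integral sigma ndF mF mfF (fun i z _ => f0 z).
rewrite /dens_measure;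
have /cvg_lim <- // :=
  ge0_nondecreasing_set_cvg_integral (mu := sigma) ndF mF mfF (fun i z _ => f0 z).
by have /cvg_lim <- // := ereal_nondecreasing_cvgn nd.
Qed.

End density.

(** * Wolff potentials of measures with density *)

Section wolff.
Context {R : realType} {n : nat} (sigma : {measure set (Rn R n) -> \bar R}).
Context (alpha p : R) (p1 : 1 < p).
Local Open Scope ereal_scope.
Implicit Types (f g : Rn R n -> \bar R) (x y : Rn R n).

Let s := (1 / (p - 1))%R.

Let s0 : (0 < s)%R. Proof. by rewrite /s divr_gt0// subr_gt0. Qed.

Let b := (alpha * p - n%:R)%R.

Lemma wolffE (nu : set (Rn R n) -> \bar R) x :
  wolff alpha p nu x = pot b s (fun t => nu (eball x t)).
Proof. by []. Qed.

Lemma wolff_ge0 (nu : set (Rn R n) -> \bar R) x : 0 <= wolff alpha p nu x.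
Proof. exact: pot_ge0. Qed.

Lemma wolff_dens1 x : wolff alpha p (dens_measure (fun=> 1) sigma) x = wolff alpha p sigma x.
Proof.
rewrite !wolffE; congr (pot b s _); apply/funext => t.
by rewrite dens1//; exact: measurable_eball.
Qed.

Lemma wolff_le f g x : nnegmeas f -> nnegmeas g -> (forall y, f y <= g y) ->
  wolff alpha p (dens_measure f sigma) x <= wolff alpha p (dens_measure g sigma) x.
Proof.
move=> nf ng fg; apply: pot_le => //; [exact: dens_profile..|].
by move=> t _; apply: dens_le => //; exact: measurable_eball.
Qed.

Lemma wolff_cmul f x (c : R) : (0 <= c)%R -> nnegmeas f ->
  wolff alpha p (dens_measure (fun y => c%:E * f y) sigma) x =
  (c `^ s)%:E * wolff alpha p (dens_measure f sigma) x.
Proof.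
move=> c0 nf; rewrite !wolffE -pot_cmul//; last exact: dens_profile.
congr (pot b s _); apply/funext => t.
by rewrite dens_cmul//; exact: measurable_eball.
Qed.

Lemma wolff_add f g x : nnegmeas f -> nnegmeas g ->
  wolff alpha p (dens_measure (fun y => f y + g y) sigma) x <=
  (2 `^ s)%:E * (wolff alpha p (dens_measure f sigma) x +
                 wolff alpha p (dens_measure g sigma) x).
Proof.
move=> nf ng; rewrite !wolffE.
have -> : (fun t => dens_measure (fun y => f y + g y) sigma (eball x t)) =
    (fun t => dens_measure f sigma (eball x t) + dens_measure g sigma (eball x t)).
  by apply/funext => t; rewrite dens_add//; exact: measurable_eball.
by apply: pot_add => //; exact: dens_profile.
Qed.

Lemma wolff_sup (f : nat -> Rn R n -> \bar R) x :
  (forall k, nnegmeas (f k)) -> (forall x j k, (j <= k)%N -> f j x <= f k x) ->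
  wolff alpha p (dens_measure (fun y => ereal_sup (range (f^~ y))) sigma) x =
  ereal_sup (range (fun k => wolff alpha p (dens_measure (f k) sigma) x)).
Proof.
move=> nf ndf; rewrite wolffE -pot_sup//.
- congr (pot b s _); apply/funext => t.
  by rewrite dens_sup//; exact: measurable_eball.
- by move=> k; exact: dens_profile.
- by move=> t j k jk; apply: dens_le => //; [exact: measurable_eball|move=> y; exact: ndf].
Qed.

(** [B(x, t - 1/(k+1))] lies in [B(y,t)] for every [y] within [1/(k+1)] of [x], so the potential at
    [x] with shrunken radii bounds the one at [y] from below; as [k] grows these shrunken potentials
    increase to the potential at [x]. *)
Lemma wolff_lsc f x (a : \bar R) : nnegmeas f -> a < wolff alpha p (dens_measure f sigma) x ->
  exists2 d, (0 < d)%R & forall y, (enorm (y - x : 'rV[R]_n) < d)%R ->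
    a < wolff alpha p (dens_measure f sigma) y.
Proof.
move=> nf; rewrite wolffE.
have -> : (fun t => dens_measure f sigma (eball x t)) =
   fun t => ereal_sup (range (fun k : nat => dens_measure f sigma (eball x (t - k.+1%:R^-1)))).
  by apply/funext => t; exact: dens_eball_sup.
have pk (k : nat) : profile (fun t => dens_measure f sigma (eball x (t - k.+1%:R^-1))).
  exact: profile_shift (dens_profile _ _ nf).
rewrite (@pot_sup _ _ _ _ (fun (k : nat) t => dens_measure f sigma (eball x (t - k.+1%:R^-1))))//; last first.
  move=> t j k jk; apply: (dens_profile _ _ nf).2.
  by rewrite lerD2l lerN2 lef_pV2 ?posrE ?ltr0n// ler_nat ltnS.
move=> /ereal_sup_gtP[_ [k _ <-] ak]; exists k.+1%:R^-1%R; first by rewrite invr_gt0.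
move=> y yx; apply: (lt_le_trans ak); apply: pot_le => //; first exact: dens_profile.
move=> t _; apply: dens_subset => //; [exact: measurable_eball..|].
by apply: subset_eball; rewrite enormB addrCA gerDl subr_le0 ltW.
Qed.

Lemma wolff_nnegmeas f : nnegmeas f -> nnegmeas (wolff alpha p (dens_measure f sigma)).
Proof.
move=> nf; split=> [|x]; last exact: wolff_ge0.
by apply: lsc_measurable => x a; exact: wolff_lsc.
Qed.

Lemma wolff_sigma_nnegmeas : nnegmeas (wolff alpha p sigma).
Proof.
rewrite (_ : wolff alpha p sigma = wolff alpha p (dens_measure (fun=> 1) sigma)).
  by apply: wolff_nnegmeas; exact: nnegmeas_cst.
by apply/funext => x; rewrite wolff_dens1.
Qed.

End wolff.

(** * A point avoiding a null set *)

Lemma measurable_coordwise_itv (R : realType) (n : nat) (d : measure_display)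
    (T : measurableType d) (Y : 'I_n -> T -> R) (a b : 'I_n -> R) :
  (forall i, measurable_fun [set: T] (Y i)) ->
  measurable [set w | forall i, a i <= Y i w <= b i].
Proof.
move=> mY; rewrite [X in measurable X](_ : _ =
    \bigcap_(j in [set: 'I_n]) (Y j @^-1` `[a j, b j])).
  apply: fin_bigcap_measurable => // j _.
  by rewrite -[X in measurable X]setTI; exact: mY.
apply/seteqP; split=> [w h j _|w h j]; first by rewrite /= in_itv/=.
by have := h j Logic.I; rewrite /= in_itv.
Qed.

Section unit_cube.
Context {R : realType}.

Lemma uniform_clamp_le (a b : R) : a <= b ->
  (uniform_prob (@ltr01 R) [set u | (a <= Num.min 1 (Num.max 0 u) <= b)%R] <= (b - a)%:E)%E.
Proof.
move=> ab; rewrite /uniform_prob integral_uniform_pdf.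
have mcl : measurable_fun [set: measurableTypeR R] (fun u : R => Num.min 1 (Num.max 0 u)).
  by apply: measurable_minr => //; apply: measurable_maxr => //; exact: measurable_id.
set S : set (measurableTypeR R) := [set u | _].
have mS : measurable S.
  have := mcl measurableT _ (measurable_itv `[a, b]); rewrite setTI.
  by congr measurable; apply/seteqP; split=> u; rewrite /S/= in_itv.
have mSI : measurable (S `&` `[0, 1]) by exact: measurableI.
apply: (@le_trans _ _ (\int[lebesgue_measure]_(x in S `&` `[0%R, 1%R]) (cst 1) x)%E).
  apply: ge0_le_integral => //.
  - by move=> x _; rewrite lee_fin uniform_pdf_ge0.
  - by apply/measurable_EFinP; apply: measurable_funTS; exact: measurable_uniform_pdf.
  - by move=> x [_]; rewrite /= in_itv/= /uniform_pdf => ->; rewrite subr0 invr1.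
rewrite integral_cst// mul1e.
apply: (@le_trans _ _ (lebesgue_measure (`[a, b] : set (measurableTypeR R)))).
  apply: le_measure; rewrite ?inE//.
  move=> x [/= + ]; rewrite /S/= !in_itv/= => + /andP[x0 x1].
  by rewrite (max_idPr x0) (min_idPr x1).
rewrite lebesgue_measure_itv/= lte_fin.
by case: ltP => // ba; rewrite lee_fin subr_ge0.
Qed.

(** The uniform law on the cube, carried by coordinate functions on a product probability space. The
    upper bound on boxes is all that coverings by boxes and the Fubini estimate call for. *)
Lemma unit_cube_prob (n : nat) : exists (d : measure_display) (T : measurableType d)
    (P : probability T R) (Y : 'I_n -> T -> R),
  [/\ forall i, measurable_fun [set: T] (Y i), forall i w, 0 <= Y i w <= 1 &
      forall a b : 'I_n -> R, (forall i, a i <= b i) ->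
       (P [set w | forall i, (a i <= Y i w <= b i)%R] <= (\prod_(i < n) (b i - a i))%:E)%E].
Proof.
elim: n => [|n [d [T [P [Y [mY Y01 PY]]]]]].
  (* For [n = 0] any probability space serves: the empty product is 1. *)
  exists _, (measurableTypeR R), (uniform_prob (@ltr01 R)), (fun _ _ => 0).
  split=> [i|i w|a b _]; rewrite ?lexx ?ler01//.
  by rewrite big_ord0; apply: probability_le1; rewrite [X in measurable X](_ : _ = setT)//;
    apply/seteqP; split=> // w _ [].
(* The uniform law lives on the whole line; clamping makes the coordinate lie in [0, 1] everywhere
   instead of almost surely. *)
pose cl (u : R) : R := Num.min 1 (Num.max 0 u).
have mcl : measurable_fun [set: measurableTypeR R] (cl : measurableTypeR R -> R).
  by apply: measurable_minr => //; apply: measurable_maxr => //; exact: measurable_id.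
pose Y' (i : 'I_n.+1) (w : T * measurableTypeR R) : R :=
  if unlift ord0 i is Some j then Y j w.1 else cl w.2.
exists _, (T * measurableTypeR R)%type, (P \x uniform_prob (@ltr01 R))%E, Y'.
split=> [i|i w|a b ab].
- rewrite /Y'; case: unliftP => [j _|_].
    by apply: measurableT_comp (mY j) _; exact: measurable_fst.
  by apply: measurableT_comp mcl _; exact: measurable_snd.
- rewrite /Y'; case: unliftP => [j _|_]; first exact: Y01.
  by rewrite /cl le_min ler01 le_max lexx/= ge_min lexx.
have -> : [set w | forall i, a i <= Y' i w <= b i] =
   [set w | forall j, a (lift ord0 j) <= Y j w <= b (lift ord0 j)] `*`
   [set u | a ord0 <= cl u <= b ord0].
  apply/seteqP; split=> [w h|[w u] [/= h1 h2] i].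
    by split=> [j|]; [have := h (lift ord0 j)|have := h ord0]; rewrite /Y' ?liftK ?unlift_none.
  by rewrite /Y'; case: unliftP => [j ->|->]; [exact: h1|exact: h2].
have m1 : measurable [set w | forall j, a (lift ord0 j) <= Y j w <= b (lift ord0 j)].
  exact: measurable_coordwise_itv.
have m2 : measurable ([set u | a ord0 <= cl u <= b ord0] : set (measurableTypeR R)).
  have := mcl measurableT _ (measurable_itv `[a ord0, b ord0]); rewrite setTI.
  by congr measurable; apply/seteqP; split=> u; rewrite /= in_itv.
rewrite [leLHS]product_measure1E// big_ord_recl mulrC EFinM.
by apply: lee_pmul => //; [exact: PY|exact: uniform_clamp_le].
Qed.

End unit_cube.

(** * A uniform random point of a small cube *)

Section random_point.
Context {R : realType} {n : nat} {dT : measure_display} {T : measurableType dT}.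
Context (P : probability T R) (Y : 'I_n -> T -> R).
Hypothesis mY : forall i, measurable_fun [set: T] (Y i).
Hypothesis PY : forall a b : 'I_n -> R, (forall i, a i <= b i) ->
  (P [set w | forall i, (a i <= Y i w <= b i)%R] <= (\prod_(i < n) (b i - a i))%:E)%E.
Context (x : 'rV[R]_n) (d : R).
Hypothesis d0 : 0 < d.

Definition cube_point (w : T) : 'rV[R]_n := \row_i (x ord0 i + d * Y i w).

Lemma cube_point_boxE (a b : 'rV[R]_n) :
  [set w | box a b (cube_point w)] =
  [set w | forall i, (a ord0 i - x ord0 i) / d <= Y i w <= (b ord0 i - x ord0 i) / d].
Proof.
by apply/seteqP; split=> w h i; have := h i; rewrite /= mxE ler_pdivrMr// ler_pdivlMr//
  lerBlDr lerBrDr mulrC addrC.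
Qed.

Lemma measurable_cube_point_box (a b : 'rV[R]_n) :
  measurable [set w | box a b (cube_point w)].
Proof. by rewrite cube_point_boxE; exact: measurable_coordwise_itv. Qed.

Lemma cube_point_box_le (a b : 'rV[R]_n) : (forall i, a ord0 i <= b ord0 i) ->
  (P [set w | box a b (cube_point w)] <= (box_vol a b / d ^+ n)%:E)%E.
Proof.
move=> ab; rewrite cube_point_boxE; apply: le_trans (PY _) _.
  by move=> i; rewrite ler_pM2r ?invr_gt0// lerD2r.
rewrite lee_fin le_eqVlt; apply/orP; left; apply/eqP.
rewrite -[X in _ / _ ^+ X]card_ord -prodr_const -prodf_div.
by apply: eq_bigr => i _; rewrite -mulrBl opprB addrA subrK.
Qed.

Lemma measurable_cube_ball (t : R) :
  measurable [set p : T * Rn R n | enorm ((p.2 : 'rV[R]_n) - cube_point p.1) < t].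
Proof.
pose g (p : T * Rn R n) := \sum_(i < n) ((p.2 : 'rV[R]_n) ord0 i - (x ord0 i + d * Y i p.1)) ^+ 2.
have mg : measurable_fun [set: T * Rn R n] g.
  apply: measurable_sum => i; apply: measurable_funX; apply: measurable_funB.
    by apply: measurableT_comp (measurable_coord i) _; exact: measurable_snd.
  apply: measurable_funD => //; apply: measurable_funM => //.
  by apply: measurableT_comp (mY i) _; exact: measurable_fst.
have ms : measurable_fun [set: R] (@Num.sqrt R).
  by apply: continuous_measurable_fun; exact: sqrt_continuous.
have msg := measurableT_comp ms mg.
have gE p : Num.sqrt (g p) = enorm ((p.2 : 'rV[R]_n) - cube_point p.1).
  by congr Num.sqrt; apply: eq_bigr => i _; rewrite !mxE.
have := msg measurableT _ (measurable_itv `]-oo, t[); rewrite setTI.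
by congr measurable; apply/seteqP; split=> p; rewrite /= in_itv/= gE.
Qed.

Context (m : {finite_measure set (Rn R n) -> \bar R}).

Lemma measurable_cube_ball_mass (t : R) :
  measurable_fun [set: T] (fun w => m (eball (cube_point w) t)).
Proof.
have := measurable_fun_xsection m (measurable_cube_ball t).
congr measurable_fun; apply/funext => w /=; congr (m _).
by apply/seteqP; split=> z; rewrite xsectionE.
Qed.

(** By Tonelli the expectation is the [m]-integral over [z] of the probability that the random point
    falls within [t] of [z]. It then lies in a cube of side [2t] around [z], which has probability
    at most [(2t/d)^n]. *)
Lemma cube_ball_mass_le (t : R) : 0 <= t ->
  (\int[P]_w m (eball (cube_point w) t) <= ((2 * t / d) ^+ n)%:E * m [set: Rn R n])%E.
Proof.
move=> t0; have mA := measurable_cube_ball t.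
have := indic_fubini_tonelli P m mA.
rewrite indic_fubini_tonelli_FE// indic_fubini_tonelli_GE// => FG.
have -> : (\int[P]_w m (eball (cube_point w) t) =
    \int[P]_w (m \o xsection [set p : T * Rn R n |
      (enorm ((p.2 : 'rV[R]_n) - cube_point p.1) < t)%R]) w)%E.
  apply: eq_integral => w _ /=; congr (m _).
  by apply/seteqP; split=> z; rewrite xsectionE.
rewrite FG -integral_cst//; apply: ge0_le_integral => //.
- exact: measurable_fun_ysection.
move=> z _ /=.
pose a : 'rV[R]_n := \row_i ((z : 'rV[R]_n) ord0 i - t).
pose b : 'rV[R]_n := \row_i ((z : 'rV[R]_n) ord0 i + t).
apply: (@le_trans _ _ (P [set w | box a b (cube_point w)])).
  apply: le_measure; rewrite ?inE; [exact: measurable_ysection|exact: measurable_cube_point_box|].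
  move=> w; rewrite ysectionE /= => zt i.
  have := le_lt_trans (coord_le_enorm _ i) zt.
  rewrite /a /b !mxE -/(cube_point w) => h; rewrite -ler_distlC; move: h.
  by rewrite distrC => /ltW.
apply: le_trans (cube_point_box_le _) _.
  by move=> i; rewrite !mxE lerD2l (le_trans _ t0)// oppr_le0.
rewrite lee_fin le_eqVlt; apply/orP; left; apply/eqP.
rewrite expr_div_n; congr (_ / _); rewrite /box_vol.
rewrite (eq_bigr (fun=> 2 * t)); first by rewrite prodr_const card_ord.
by move=> i _; rewrite !mxE; ring.
Qed.

End random_point.

(** * Control of all dyadic balls around one point *)

Section good_point.
Context {R : realType} {n : nat}.

Lemma nneseries_geometric_le (lam c : R) : 0 < lam < 1 -> 0 <= c ->
  (\sum_(k <oo) (c * (1 - lam) * lam ^+ k)%:E <= c%:E)%E.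
Proof.
move=> /andP[l0 l1] c0; apply: lime_le.
  apply: is_cvg_nneseries => k _ _; rewrite lee_fin mulr_ge0 ?exprn_ge0 ?(ltW l0)//.
  by rewrite mulr_ge0// subr_ge0 ltW.
apply: nearW => k; rewrite sumEFin lee_fin -mulr_sumr big_mkord.
rewrite -mulrA -[leRHS]mulr1; apply: ler_wpM2l => //.
have -> : (1 - lam) * (\sum_(i < k) lam ^+ i) = 1 - lam ^+ k.
  by rewrite -[in RHS](expr1n R k) -/(_ - _) subrXX; congr (_ * _); apply: eq_bigr => i _;
    rewrite expr1n mul1r.
by rewrite gerBl exprn_ge0// ltW.
Qed.

(** A union bound over all scales: the failure probability allotted to scale [k] is proportional to
    [lam^k], so the mass bound loses [lam^-k] against the averaged decay [2^(-n k)]. *)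
Lemma good_point (sigma : {measure set (Rn R n) -> \bar R}) (N : set (Rn R n))
    (x : Rn R n) (d lam : R) :
  locally_finite_measure sigma -> lebesgue_null N -> 0 < d -> 0 < lam < 1 ->
  exists y : Rn R n, [/\ ~ N y, enorm (y - x : 'rV[R]_n) <= n%:R * d &
    forall k : nat, (sigma (eball y (d / 2 ^+ k)) <=
      (2 ^+ n * 4 / (1 - lam) * ((2 ^+ n) ^-1 / lam) ^+ k)%:E *
      sigma (eball x ((n%:R + 1) * d)))%E].
Proof.
move=> lfs nullN d0 lam01.
have [dT [T [P [Y [mY Y01 PY]]]]] := @unit_cube_prob R n.
have /andP[l0 l1] := lam01.
have mB := measurable_eball x ((n%:R + 1) * d).
have sBfin : (sigma (eball x ((n%:R + 1) * d)) < +oo)%E := lfs x _.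
(* Tonelli is applied to a finite measure. The balls [B(y, d/2^k)] all lie in [B(x, (n+1)d)], so
   restricting [sigma] to the latter keeps their masses. *)
pose m : {finite_measure set (Rn R n) -> \bar R} := mfrestr mB sBfin.
pose y := cube_point Y x d.
have yx w : enorm (y w - x) <= n%:R * d.
  apply: enorm_le_coord; first exact: ltW.
  move=> i; rewrite !mxE addrC addKr normrM (gtr0_norm d0) ler_piMr ?(ltW d0)//.
  by have /andP[? ?] := Y01 i w; rewrite ger0_norm.
have mE w (k : nat) : m (eball (y w) (d / 2 ^+ k)) = sigma (eball (y w) (d / 2 ^+ k)).
  rewrite /m /= /mfrestr /mrestr setIidl//; apply: subset_eball.
  rewrite mulrDl mul1r lerD// ler_pdivrMr ?exprn_gt0// ler_peMr ?(ltW d0)//.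
  by rewrite exprn_ege1// ler1n.
have mT : m setT = sigma (eball x ((n%:R + 1) * d)).
  by rewrite /m /= /mfrestr /mrestr setTI.
pose M := fine (sigma (eball x ((n%:R + 1) * d))).
have ME : sigma (eball x ((n%:R + 1) * d)) = M%:E.
  by rewrite fineK// ge0_fin_numE.
have M0 : 0 <= M by rewrite fine_ge0.
(* [M'] replaces [M] as a divisor, since [M] may vanish. *)
pose M' := if M == 0 then 1 else M.
have M'0 : 0 < M' by rewrite /M'; case: eqP => // /eqP; rewrite lt_neqAle eq_sym M0 andbT.
have MM' : M <= M' by rewrite /M'; case: eqP => // ->; exact: ler01.
(* The expected mass at scale [k] is at most [(2/2^k)^n M]; divided by [H k M'] it is at most
   [(1 - lam) lam^k / 4], which sums to 1/4. The boxes covering [N], of total volume at most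
   [d^n / 4], account for another 1/4. *)
pose H (k : nat) := 2 ^+ n * 4 / (1 - lam) * ((2 ^+ n) ^-1 / lam) ^+ k.
have H0 k : 0 < H k.
  by rewrite mulr_gt0 ?exprn_gt0 ?divr_gt0 ?mulr_gt0 ?subr_gt0 ?invr_gt0 ?exprn_gt0.
have HM0 k : 0 < H k * M' by apply: mulr_gt0.
have dn0 : 0 < d ^+ n by rewrite exprn_gt0.
have [a [b [ab [Nab vab]]]] := nullN (d ^+ n / 4) ltac:(by rewrite divr_gt0).
(* A sample at which the sum of all [Phi k] is below 1 avoids every box and
   satisfies every ball bound; the expectation of that sum is at most 1/2. *)
pose Phi (k : nat) w := ((\1_[set w | box (a k) (b k) (y w)] w)%:E +
  ((H k * M')^-1)%:E * m (eball (y w) (d / 2 ^+ k)))%E.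
have Phi0 k w : (0 <= Phi k w)%E.
  by rewrite adde_ge0 ?lee_fin// mule_ge0// lee_fin invr_ge0 mulr_ge0// ltW.
have mb k := measurable_cube_point_box mY x d0 (a k) (b k).
have mm k := measurable_cube_ball_mass mY x d m (d / 2 ^+ k).
have mPhi k : measurable_fun [set: T] (Phi k).
  apply: emeasurable_funD; last exact: measurable_funeM.
  by apply/measurable_EFinP; exact: measurable_indic.
have vol0 k : 0 <= box_vol (a k) (b k).
  by apply: prodr_ge0 => i _; rewrite subr_ge0.
have intPhi k : (\int[P]_w Phi k w <= (box_vol (a k) (b k))%:E * (d ^+ n)^-1%:E +
    (4^-1 * (1 - lam) * lam ^+ k)%:E)%E.
  rewrite ge0_integralD//; last 3 first.
  - by apply/measurable_EFinP; exact: measurable_indic.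
  - by move=> w _; rewrite mule_ge0// lee_fin invr_ge0 mulr_ge0// ltW.
  - exact: measurable_funeM.
  apply: leeD.
    by rewrite integral_indic// setIT -EFinM; exact: cube_point_box_le.
  rewrite ge0_integralZl//; last by rewrite lee_fin invr_ge0 mulr_ge0// ltW.
  have t0 : 0 <= d / 2 ^+ k by rewrite divr_ge0 ?exprn_ge0 ?(ltW d0).
  apply: le_trans (lee_wpmul2l _ (cube_ball_mass_le mY PY x d0 m t0)) _.
    by rewrite lee_fin invr_ge0 mulr_ge0// ltW.
  rewrite mT ME -!EFinM lee_fin mulrC (ler_pdivrMr _ _ (HM0 k)).
  apply: (@le_trans _ _ ((2 * (d / 2 ^+ k) / d) ^+ n * M')).
    by apply: ler_wpM2l => //; rewrite exprn_ge0// divr_ge0 ?mulr_ge0// ltW.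
  rewrite le_eqVlt; apply/orP; left; apply/eqP.
  rewrite [RHS]mulrA; congr (_ * _); rewrite /H.
  have -> : 2 * (d / 2 ^+ k) / d = 2 / 2 ^+ k by field; rewrite gt_eqF//= gt_eqF ?exprn_gt0.
  rewrite !expr_div_n !exprVn exprAC; field.
  by rewrite subr_eq0 !expf_neq0 ?(gt_eqF l0) ?(gt_eqF l1)// expf_neq0.
have [w Phiw] : exists w, (\sum_(k <oo) Phi k w < 1)%E.
  apply/not_existsP => hw.
  have : (\int[P]_w (\sum_(k <oo) Phi k w) <= (2^-1)%:E)%E.
    rewrite integral_nneseries//.
    apply: (@le_trans _ _ (\sum_(k <oo) ((box_vol (a k) (b k))%:E * (d ^+ n)^-1%:E +
        (4^-1 * (1 - lam) * lam ^+ k)%:E)))%E.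
      by apply: lee_nneseries => [j _ _|j _]; [exact: integral_ge0|exact: intPhi].
    rewrite nneseriesD//; last 2 first.
    - by move=> k _ _; rewrite -EFinM lee_fin mulr_ge0// invr_ge0 ltW.
    - by move=> k _ _; rewrite lee_fin mulr_ge0 ?exprn_ge0 ?(ltW l0)// mulr_ge0// subr_ge0 ltW.
    have -> : (2^-1 : R)%:E = ((4^-1 : R)%:E + (4^-1 : R)%:E)%E by rewrite -EFinD; congr EFin; field.
    apply: leeD; last exact: nneseries_geometric_le.
    under eq_eseriesr do rewrite muleC.
    rewrite nneseriesZl//; last by move=> k _; rewrite lee_fin.
    apply: le_trans (lee_wpmul2l _ vab) _; first by rewrite lee_fin invr_ge0 ltW.
    by rewrite -EFinM lee_fin mulrA mulVf ?mul1r// gt_eqF.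
  apply/negP; rewrite -ltNge; apply: (@lt_le_trans _ _ 1%E).
    by rewrite lte_fin invf_lt1// ltr1n.
  rewrite -[leLHS](probability_setT P) -[leLHS]mul1e -integral_cst//.
  apply: ge0_le_integral => //.
    by apply: ge0_emeasurable_sum => //.
  by move=> w _ /=; rewrite leNgt; apply/negP; exact: hw.
have Phikw k : (Phi k w < 1)%E.
  apply: le_lt_trans Phiw; rewrite (@nneseriesD1 _ (fun k => Phi k w) k)// leeDl//.
  by apply: nneseries_ge0.
exists (y w); split=> [/Nab[k _ yk]||k].
- have := Phikw k; rewrite /Phi indicE mem_set// => /lt_geF/negP; apply.
  by rewrite leeDl// mule_ge0// lee_fin invr_ge0 mulr_ge0// ltW.
- exact: yx.
- rewrite -mE ME -/(H k).
  (* If [M = 0] the restricted measure vanishes and monotonicity suffices; otherwise [M' = M], and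
     clearing the denominator in [Phi k w < 1] gives the bound. *)
  have [M00|M00] := eqVneq M 0.
    rewrite M00 mule0 -[leRHS]/(0%:E) -M00 -ME -mT.
    by apply: le_measure; rewrite ?inE//; exact: measurable_eball.
  have M'E : M' = M by rewrite /M' (negbTE M00).
  have : (((H k * M')^-1)%:E * m (eball (y w) (d / 2 ^+ k)) <= 1)%E.
    apply: ltW; apply: le_lt_trans (Phikw k); rewrite /Phi leeDr// lee_fin.
  rewrite -M'E -EFinM muleC -lee_pdivlMr ?invr_gt0//.
  by rewrite mul1e invrK.
Qed.

End good_point.

(** * Comparison at a nearby point outside a null set *)

Section dyadic.
Context {R : realType}.

Lemma dyadic_annulus (d t : R) : 0 < t -> t <= d ->
  exists k : nat, d / 2 ^+ k.+1 < t <= d / 2 ^+ k.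
Proof.
move=> t0 td.
have ex : exists j : nat, d / 2 ^+ j < t.
  have d0 := lt_le_trans t0 td.
  exists (Num.bound (d / t)); rewrite ltr_pdivrMr ?exprn_gt0// mulrC -ltr_pdivrMr//.
  apply: lt_le_trans (archi_boundP _) _; first by rewrite divr_ge0 ?(ltW d0) ?(ltW t0).
  by rewrite -natrX ler_nat ltnW// ltn_expl.
(* The least [j] with [d / 2^j < t] is positive because [t <= d]; its predecessor is the index
   sought. *)
have := ex_minnP ex; case=> -[|k]; first by rewrite expr0 divr1 => /(le_lt_trans td); rewrite ltxx.
move=> h1 h2; exists k; rewrite h1/= leNgt; apply/negP => /h2.
by rewrite ltnn.
Qed.

Local Open Scope ereal_scope.

(** The denominator [d / 2^(k+1)] is the length of the [k]-th annulus, so that annulus contributes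
    at most [c rho^k]. *)
Lemma integral_dyadic_le (f : measurableTypeR R -> \bar R) (d c rho : R) :
  (0 < d)%R -> (0 <= c)%R -> (0 < rho < 1)%R ->
  measurable_fun (T := measurableTypeR R) `]0%R, +oo[ f ->
  (forall t, (0 < t)%R -> 0 <= f t) ->
  (forall (k : nat) t, (d / 2 ^+ k.+1 < t <= d / 2 ^+ k)%R ->
     f t <= (c * rho ^+ k / (d / 2 ^+ k.+1))%:E) ->
  \int[@lebesgue_measure R]_(t in `]0%R, d]) f t <= (c / (1 - rho))%:E.
Proof.
move=> d0 c0 rho01 mf f0 fle.
have /andP[r0 r1] := rho01.
pose Ak (k : nat) : set (measurableTypeR R) := `](d / 2 ^+ k.+1)%R, (d / 2 ^+ k)%R]%classic.
have dk0 (k : nat) : (0 < d / 2 ^+ k)%R by rewrite divr_gt0 ?exprn_gt0.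
pose ck (k : nat) : R := (c * rho ^+ k / (d / 2 ^+ k.+1))%R.
have ck0 k : (0 <= ck k)%R.
  by rewrite /ck divr_ge0 ?mulr_ge0 ?exprn_ge0 ?(ltW r0)// ltW// dk0.
have mAk k : measurable (Ak k) by exact: measurable_itv.
pose F (k : nat) (t : measurableTypeR R) := (ck k)%:E * (\1_(Ak k) t)%:E.
have F0 k t : 0 <= F k t by rewrite mule_ge0// lee_fin.
have mF k : measurable_fun [set: measurableTypeR R] (F k).
  by apply: measurable_funeM; apply/measurable_EFinP; exact: measurable_indic.
have sub : `]0%R, d] `<=` (`]0%R, +oo[ : set (measurableTypeR R)).
  by move=> t; rewrite /= !in_itv/= andbT => /andP[].
apply: (@le_trans _ _ (\int[@lebesgue_measure R]_(t in `]0%R, d]) \sum_(k <oo) F k t)).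
  apply: ge0_le_integral => //.
  - by move=> t /sub /=; rewrite in_itv/= andbT; exact: f0.
  - exact: measurable_funS mf.
  - by apply: measurable_funTS; apply: ge0_emeasurable_sum.
  move=> t /=; rewrite in_itv/= => /andP[t0 td].
  have [k kP] := dyadic_annulus t0 td.
  rewrite (@nneseriesD1 _ (fun k => F k t) k)//.
  apply: (@le_trans _ _ (F k t)); last by rewrite leeDl//; exact: nneseries_ge0.
  by rewrite /F indicE mem_set ?mule1 ?fle// /Ak/= in_itv.
apply: (@le_trans _ _ (\int[@lebesgue_measure R]_t \sum_(k <oo) F k t)).
  apply: ge0_subset_integral => //; first by apply: ge0_emeasurable_sum.
  by move=> t _; exact: nneseries_ge0.
rewrite integral_nneseries//.
apply: le_trans (nneseries_geometric_le rho01 (divr_ge0 c0 (_ : 0 <= 1 - rho)%R)); last first.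
  by rewrite subr_ge0 ltW.
apply: lee_nneseries => [k _ _|k _]; first exact: integral_ge0.
rewrite /F ge0_integralZl//; last 2 first.
- by apply/measurable_EFinP; exact: measurable_indic.
- by rewrite lee_fin.
rewrite integral_indic//= setIT /Ak lebesgue_measure_itv/= lte_fin.
have -> : (d / 2 ^+ k = 2 * (d / 2 ^+ k.+1))%R.
  by rewrite exprS; field; rewrite expf_neq0.
rewrite ltr_pMl// ltr1n -EFinD -EFinM lee_fin le_eqVlt; apply/orP; left; apply/eqP.
rewrite mulr_natl mulr2n addrK /ck mulfVK ?gt_eqF// mulfVK// gt_eqF//.
by rewrite subr_gt0.
Qed.

End dyadic.

Section wolff_good_point.
Context {R : realType} {n : nat} (alpha p : R).
Hypotheses (p1 : 1 < p) (alpha0 : 0 < alpha) (alphan : alpha < n%:R / p).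
Local Open Scope ereal_scope.

(** Radii up to [d] use the dyadic bounds of [good_point]. For larger ones [B(y,t)] lies in
    [B(x, (n+1)t)], and a dilation removes the factor [n+1]. *)
Lemma wolff_good_point : exists2 C : R, (0 < C)%R &
  forall (sigma : {measure set (Rn R n) -> \bar R}) (N : set (Rn R n)) (x : Rn R n) (delta : R),
  locally_finite_measure sigma -> lebesgue_null N -> (0 < delta)%R ->
  exists y : Rn R n, [/\ ~ N y, (enorm (y - x : 'rV[R]_n) < delta)%R &
    wolff alpha p sigma y <= C%:E * wolff alpha p sigma x].
Proof.
have p0 : (0 < p)%R by exact: lt_trans p1.
set s := (1 / (p - 1))%R; have s0 : (0 < s)%R by rewrite divr_gt0// subr_gt0.
set b := (alpha * p - n%:R)%R.
have b0 : (b <= 0)%R by rewrite subr_le0 -ler_pdivlMr// ltW.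
have ap0 : (0 < alpha * p / 2)%R by rewrite divr_gt0// mulr_gt0.
have pow1 u : (1 `^ u = 1 :> R)%R by rewrite powR1.
(* [lam ^ 2 = 2 ^ (- alpha p)]: the masses of the dyadic balls given by
   [good_point] then make the annuli contribute a geometric series of ratio
   [rho = lam ^ s]. *)
pose lam : R := (2^-1 `^ (alpha * p / 2))%R.
have lam01 : (0 < lam < 1)%R.
  rewrite powR_gt0//= /lam -[ltRHS](pow1 (alpha * p / 2)%R).
  by apply: gt0_ltr_powR => //; rewrite ?nnegrE// invf_lt1// ltr1n.
have /andP[l0 l1] := lam01.
pose rho := (lam `^ s)%R.
have rho01 : (0 < rho < 1)%R.
  rewrite powR_gt0//= /rho -[ltRHS](pow1 s); apply: gt0_ltr_powR => //; rewrite nnegrE//.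
  exact: ltW.
have /andP[r0 r1] := rho01.
pose K := (2 ^+ n * 4 / (1 - lam))%R.
have K0 : (0 < K)%R by rewrite divr_gt0 ?mulr_gt0 ?exprn_gt0 ?subr_gt0.
pose n1 : R := (n%:R + 1)%R.
have n10 : (0 < n1)%R by rewrite ltr_wpDl.
(* [C1] pays for radii up to [d]: the geometric sum, expressed through the mass of [B(x, n1 d)], is
   compared with [w x] by [pot_ge] at [T = n1 d]; [4 n1] is the ratio of [2 n1 d] to [d/2]. [C2]
   pays for the dilation by [n1] at larger radii. *)
pose C1 := ((K * (4 * n1) `^ (- b)) `^ s * 2 / (1 - rho))%R.
pose C2 := ((n1 `^ (b * s))^-1)%R.
have C10 : (0 < C1)%R.
  by rewrite divr_gt0 ?subr_gt0// mulr_gt0// powR_gt0// mulr_gt0// powR_gt0// mulr_gt0.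
have C20 : (0 < C2)%R by rewrite invr_gt0 powR_gt0.
exists (C1 + C2)%R; first by rewrite addr_gt0.
move=> sigma N x delta lfs nullN delta0.
pose d := (delta / n1)%R.
have d0 : (0 < d)%R by rewrite divr_gt0.
have [y [Ny yx yk]] := good_point x lfs nullN d0 lam01.
exists y; split=> //.
  apply: le_lt_trans yx _; rewrite /d mulrA ltr_pdivrMr// mulrC ltr_pM2l//.
  by rewrite /n1 ltrDl.
pose mx t := sigma (eball x t); pose my t := sigma (eball y t).
have pm z : profile (fun t => sigma (eball z t)).
  split=> [t|t r tr]; first exact: measure_ge0.
  by apply: le_measure; rewrite ?inE; [exact: measurable_eball..|exact: subset_eballr].
have mk m : profile m -> measurable_fun (T := measurableTypeR R) `]0%R, +oo[ (kern b s m).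
  by move=> hm; apply: measurable_kern; exact: profile_measurable.
rewrite !wolffE -/s -/b -/mx -/my EFinD ge0_muleDl ?lee_fin ?(ltW C10) ?(ltW C20)//.
have split0 : `]0%R, +oo[%classic = `]0%R, d]%classic `|` `]d, +oo[%classic :> set (measurableTypeR R).
  by rewrite -itv_bndbnd_setU// bnd_simp ltW.
have dT : [disjoint (`]0%R, d]%classic : set (measurableTypeR R)) & `]d, +oo[%classic].
  apply/disj_setPS => t /=; rewrite !in_itv/= andbT => -[/andP[_ td] dt].
  by rewrite ltNge td in dt.
rewrite {1}/pot split0 ge0_integral_setU//; last 2 first.
- by rewrite -split0; apply: mk; exact: pm.
- by move=> t; rewrite -split0/= in_itv/= andbT; exact: kern_ge0.
have mxfin : mx (n1 * d)%R = (fine (mx (n1 * d)%R))%:E.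
  by rewrite fineK// ge0_fin_numE ?(pm x).1//; exact: lfs.
set M := fine (mx (n1 * d)%R) in mxfin.
have M0 : (0 <= M)%R by rewrite fine_ge0// (pm x).1.
apply: leeD.
  apply: (@le_trans _ _ (((K * M * (d / 2) `^ b) `^ s / (1 - rho))%:E)).
    apply: integral_dyadic_le => //; first exact: powR_ge0.
    - by apply: mk; exact: pm.
    - exact: kern_ge0.
    move=> k t /andP[kt tk].
    have dk0 : (0 < d / 2 ^+ k.+1)%R by rewrite divr_gt0 ?exprn_gt0.
    have t0 := lt_trans dk0 kt.
    rewrite /kern EFinM; apply: lee_pmul; rewrite ?poweR_ge0 ?lee_fin ?invr_ge0 ?(ltW t0)//; last first.
      by rewrite lef_pV2 ?posrE// ltW.
    have -> : (((K * M * (d / 2) `^ b) `^ s * rho ^+ k)%R%:E =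
       poweR ((K * ((2 ^+ n)^-1 / lam) ^+ k * M) * ((d / 2 ^+ k.+1) `^ b))%R%:E s).
      rewrite poweR_EFin; congr EFin.
      have -> : (rho ^+ k = (lam ^+ k) `^ s)%R
        by rewrite /rho -(powR_mulrn k (powR_ge0 _ s)) -(powR_mulrn k (ltW l0)) powRAC.
      rewrite -powRM ?exprn_ge0 ?(ltW l0)//; last by apply: mulr_ge0; [exact: mulr_ge0 (ltW K0) M0|exact: powR_ge0].
      congr powR.
      have h0 : (0 <= 2^-1 :> R)%R by [].
      have -> : (d / 2 ^+ k.+1 = d / 2 * 2^-1 ^+ k)%R.
        by rewrite exprVn exprS; field; rewrite expf_neq0.
      rewrite (@powRM _ (d / 2)%R) ?exprn_ge0//; last by rewrite ltW// divr_gt0.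
      rewrite -(powR_mulrn k h0) powRAC powR_mulrn ?powR_ge0//.
      (* Halving the radius multiplies the mass bound by [2^-n / lam] and the weight [t^b] by
         [2^-b]; the product is again [lam]. *)
      have lamE : (lam = (2 ^+ n)^-1 / lam * (2^-1) `^ b)%R.
        apply: (mulIf (lt0r_neq0 l0)); rewrite mulrAC divfK ?gt_eqF//.
        rewrite /lam -powRD; last by rewrite gt_eqF ?addr_gt0.
        rewrite -exprVn -(powR_mulrn n h0) -powRD; last by rewrite implybE invr_eq0 pnatr_eq0/= orbT.
        by congr powR; rewrite /b; field.
      by rewrite [in LHS]lamE exprMn; ring.
    apply: le_poweR; rewrite ?(ltW s0) ?mule_ge0 ?(pm y).1 ?lee_fin ?powR_ge0//.
    rewrite EFinM; apply: lee_pmul; rewrite ?(pm y).1 ?lee_fin ?powR_ge0//; last first.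
      by apply: ler_npowR => //; exact: ltW.
    rewrite EFinM -mxfin; apply: le_trans (yk k); apply: (pm y).2 => //.
  have hge := @pot_ge _ b _ s0 mx (n1 * d)%R (mulr_gt0 n10 d0) b0 (pm x).
  apply: le_trans (lee_wpmul2l _ hge); last by rewrite lee_fin ltW.
  rewrite mxfin -[leRHS]/((C1 * ((M * (2 * (n1 * d)) `^ b) `^ s * 2^-1))%:E) lee_fin /C1.
  rewrite le_eqVlt; apply/orP; left; apply/eqP.
  have -> : ((2 * (n1 * d)) `^ b = (d / 2) `^ b * (4 * n1) `^ b)%R.
    rewrite -(@powRM _ (d / 2)%R (4 * n1)%R); last 2 first.
    - by rewrite ltW// divr_gt0.
    - by rewrite ltW// mulr_gt0.
    by congr powR; field.
  rewrite powRN.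
  have c0 : (0 < (4 * n1) `^ b)%R by rewrite powR_gt0// mulr_gt0.
  have -> : (K * M * (d / 2) `^ b = (K * ((4 * n1) `^ b)^-1) * (M * ((d / 2) `^ b * (4 * n1) `^ b)))%R.
    by field; rewrite gt_eqF.
  rewrite (@powRM _ (K * _)%R); last 2 first.
  - by rewrite ltW// mulr_gt0// invr_gt0.
  - by rewrite mulr_ge0// mulr_ge0 ?powR_ge0.
  by field; rewrite gt_eqF ?subr_gt0.
have hs := @pot_scale _ b s n1 mx n10 (pm x).
have -> : C2%:E * pot b s mx = pot b s (fun t => mx (n1 * t)%R).
  by rewrite hs muleA -EFinM mulVf ?mul1e// gt_eqF// powR_gt0.
apply: (@le_trans _ _ (\int[@lebesgue_measure R]_(t in `]d, +oo[) kern b s (fun t => mx (n1 * t)%R) t)).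
  have sub : `]d, +oo[ `<=` (`]0%R, +oo[ : set (measurableTypeR R)).
    by rewrite split0; exact: subsetUr.
  apply: ge0_le_integral => //.
  - by move=> t /sub/=; rewrite in_itv/= andbT; exact: kern_ge0.
  - by apply: measurable_funS (mk _ (pm y)).
  - by apply: measurable_funS (mk _ (profile_scale (ltW n10) (pm x))).
  move=> t /=; rewrite in_itv/= andbT => dt; apply: kern_le => //.
  - exact: lt_trans dt.
  - apply: le_measure; rewrite ?inE; [exact: measurable_eball..|].
    apply: subset_eball; rewrite /n1 mulrDl mul1r lerD2r (le_trans yx)//.
    by apply: ler_wpM2l => //; exact: ltW.
apply: ge0_subset_integral => //.
- by apply: mk; exact: profile_scale (ltW n10) (pm x).
- by move=> t /=; rewrite in_itv/= andbT; exact: kern_ge0.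
- by rewrite split0; exact: subsetUr.
Qed.

End wolff_good_point.

(** * Lower bound for the iterated potential *)

Section half_split.
Context {R : realType}.
Local Open Scope ereal_scope.
Local Notation leb := (@lebesgue_measure R).

(** The bound [M] makes [g] integrable, so its primitive is continuous and takes half of its final
    value at some [tau]. *)
Lemma integral_half_split (g : measurableTypeR R -> \bar R) (t0 t1 M : R) :
  (t0 <= t1)%R -> measurable_fun (T := measurableTypeR R) `[t0, t1] g ->
  (forall t, (t0 <= t <= t1)%R -> 0 <= g t <= M%:E) ->
  exists2 tau : R, (t0 <= tau <= t1)%R &
    2^-1%:E * \int[leb]_(t in `[t0, t1]) g t <= \int[leb]_(t in `[t0, tau]) g t /\
    2^-1%:E * \int[leb]_(t in `[t0, t1]) g t <= \int[leb]_(t in `[tau, t1]) g t.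
Proof.
move=> t01 mg gM.
pose f (t : measurableTypeR R) : R := fine (g t).
have gf t : (t0 <= t <= t1)%R -> g t = (f t)%:E.
  move=> /gM/andP[g0 gle]; rewrite /f fineK// ge0_fin_numE//.
  by apply: le_lt_trans gle _; exact: ltry.
have mf : measurable_fun (T := measurableTypeR R) `[t0, t1] (EFin \o f).
  apply: eq_measurable_fun mg => t; rewrite inE/= in_itv/=; exact: gf.
have intf : leb.-integrable `[t0, t1] (EFin \o f).
  apply/integrableP; split=> //.
  apply: (@le_lt_trans _ _ (\int[leb]_(t in `[t0, t1]) (cst M%:E) t)).
    apply: ge0_le_integral => //; first exact: measurableT_comp.
    move=> t /=; rewrite in_itv/= => /[dup] /gM/andP[g0 gle] /gf gE.
    by rewrite /= ger0_norm -?lee_fin -gE.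
  rewrite integral_cst//= lebesgue_measure_itv/=.
  by case: ifPn => _; rewrite -?EFinD -?EFinM ?mule0 ltry.
have sub1 tau : (tau <= t1)%R -> `[t0, tau] `<=` `[t0, t1]%classic.
  by move=> h t /=; rewrite !in_itv/= => /andP[-> /le_trans->].
have sub2 tau : (t0 <= tau)%R -> `[tau, t1] `<=` `[t0, t1]%classic.
  by move=> h t /=; rewrite !in_itv/= => /andP[/(le_trans h)-> ->].
have iE tau : (tau <= t1)%R ->
    \int[leb]_(t in `[t0, tau]) g t = (parameterized_integral leb t0 tau f)%:E.
  move=> h; rewrite /parameterized_integral /Rintegral fineK.
    by apply: eq_integral => t; rewrite inE => /(sub1 _ h) /=; rewrite in_itv/=; exact: gf.
  apply: integrable_fin_num => //; apply: integrableS intf => //; exact: sub1.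
have g0 t : `[t0, t1]%classic t -> 0 <= g t.
  by rewrite /= in_itv/= => /gM/andP[].
have cont := parameterized_integral_continuous t01 intf.
set v := parameterized_integral leb t0 t1 f.
have v0 : (0 <= v)%R by rewrite -lee_fin -iE//; exact: integral_ge0.
have p00 : parameterized_integral leb t0 t0 f = 0%R.
  by rewrite /parameterized_integral set_itv1 Rintegral_set1.
have [|tau tauin tauE] := IVT t01 cont (v := (v / 2)%R).
  by rewrite p00 -/v minElt maxElt; case: ltP => ?; lra.
move: tauin; rewrite in_itv/= => /andP[t0tau taut1].
have e1 : \int[leb]_(t in `[t0, tau]) g t = (v / 2)%:E by rewrite iE// tauE.
have e2 : 2^-1%:E * \int[leb]_(t in `[t0, t1]) g t = (v / 2)%:E.
  by rewrite iE// -EFinM mulrC.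
exists tau; first by rewrite t0tau.
rewrite e2 e1; split=> //.
have e3 : \int[leb]_(t in `[t0, t1]) g t <=
    \int[leb]_(t in `[t0, tau]) g t + \int[leb]_(t in `[tau, t1]) g t.
  have -> : `[t0, t1]%classic = `[t0, tau]%classic `|` `]tau, t1]%classic :> set (measurableTypeR R).
    by rewrite -itv_bndbnd_setU// bnd_simp.
  rewrite ge0_integral_setU//.
  - apply: leeD2l; apply: ge0_subset_integral => //.
    + exact: measurable_funS (sub2 _ t0tau) mg.
    + by move=> t /(sub2 _ t0tau)/g0.
    + by move=> t /=; rewrite !in_itv/= => /andP[/ltW -> ->].
  - by rewrite -itv_bndbnd_setU ?bnd_simp.
  - by move=> t; rewrite -itv_bndbnd_setU ?bnd_simp//; exact: g0.
  - apply/disj_setPS => t /=; rewrite !in_itv/= => -[/andP[_ h1] /andP[h2 _]].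
    by rewrite ltNge h1 in h2.
move: e3; rewrite e1 iE// -/v -leeBlDl//; apply: le_trans.
by rewrite -EFinB lee_fin; lra.
Qed.

End half_split.

Section lower_bound.
Context {R : realType} {n : nat} (alpha p r : R).
Hypotheses (p1 : 1 < p) (alphan : alpha < n%:R / p) (r0 : 0 < r).
Local Open Scope ereal_scope.

Lemma wolff_iter_ge : exists2 C : R, (0 < C)%R &
  forall (sigma : {measure set (Rn R n) -> \bar R}) (x : Rn R n),
  locally_finite_measure sigma ->
  C%:E * poweR (wolff alpha p sigma x) (r * (1 / (p - 1)) + 1) <=
  wolff alpha p (dens_measure (fun y => poweR (wolff alpha p sigma y) r) sigma) x.
Proof.
have p0 : (0 < p)%R by exact: lt_trans p1.
set s := (1 / (p - 1))%R; have s0 : (0 < s)%R by rewrite divr_gt0// subr_gt0.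
set b := (alpha * p - n%:R)%R.
have b0 : (b <= 0)%R by rewrite subr_le0 -ler_pdivlMr// ltW.
have rs0 : (0 < r * s)%R by rewrite mulr_gt0.
(* For [y] in [B(x,t)] and [t <= tau], [B(y,2u)] contains [B(x,u)] whenever
   [tau <= u], so [w y] dominates the part of the integral of [w x] beyond [tau]. *)
pose c0 := ((2 `^ (b * s) / 2) `^ r `^ s)%R.
have c00 : (0 < c0)%R by rewrite !powR_gt0// divr_gt0// powR_gt0.
(* In [c0], [2^(b s)] comes from doubling the radii and 1/2 from the outer half of the integral; the
   density raises them to [r] and the potential to [s]. The remaining 1/2 is the inner half, which
   also supplies the [+ 1] in the exponent. *)
exists (c0 / 2)%R; first by rewrite divr_gt0.
move=> sigma x lfs.
have pm z : profile (fun t => sigma (eball z t)).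
  split=> [t|t u tu]; first exact: measure_ge0.
  by apply: le_measure; rewrite ?inE; [exact: measurable_eball..|exact: subset_eballr].
have mk m : profile m -> measurable_fun (T := measurableTypeR R) `]0%R, +oo[ (kern b s m).
  by move=> hm; apply: measurable_kern; exact: profile_measurable.
set g : measurableTypeR R -> \bar R := kern b s (fun t => sigma (eball x t)).
pose W := wolff alpha p sigma.
have nW : nnegmeas W by exact: wolff_sigma_nnegmeas.
have nWr : nnegmeas (fun y => poweR (W y) r) by exact: nnegmeas_poweR.
pose nu := dens_measure (fun y => poweR (W y) r) sigma.
have pnu : profile (fun t => nu (eball x t)) by exact: dens_profile.
(* Since [w x] may be infinite, the integral is halved on a compact window [[t0, t1]], where local
   finiteness bounds the integrand. The windows [[1/(k+1), k+1]] then exhaust the half-line. *)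
have key t0 t1 : (0 < t0)%R -> (t0 <= t1)%R ->
    (c0 / 2)%:E * poweR (\int[@lebesgue_measure R]_(t in `[t0, t1]) g t) (r * s + 1) <=
    wolff alpha p nu x.
  move=> t00 t01.
  have sub a c : (t0 <= a)%R -> `[a, c] `<=` (`]0%R, +oo[ : set (measurableTypeR R)).
    by move=> ta t /=; rewrite !in_itv/= andbT => /andP[h _]; exact: lt_le_trans t00 (le_trans ta h).
  have mg a c : (t0 <= a)%R -> measurable_fun (T := measurableTypeR R) `[a, c] g.
    by move=> ta; apply: measurable_funS (sub a c ta) (mk _ (pm x)).
  have g0 t : (0 < t)%R -> 0 <= g t by move=> t0'; exact: kern_ge0.
  pose S := fine (sigma (eball x t1)).
  have SE : sigma (eball x t1) = S%:E by rewrite fineK// ge0_fin_numE//; exact: lfs.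
  pose M := ((S * t0 `^ b) `^ s * t0^-1)%R.
  have gM t : (t0 <= t <= t1)%R -> 0 <= g t <= M%:E.
    move=> /andP[t0t tt1]; have tp := lt_le_trans t00 t0t; rewrite g0//=.
    rewrite /g /kern /M EFinM -(poweR_EFin (S * t0 `^ b)%R s) (EFinM S) -SE.
    apply: lee_pmul; rewrite ?poweR_ge0 ?lee_fin ?invr_ge0 ?(ltW tp)//; last by rewrite lef_pV2 ?posrE.
    apply: le_poweR; rewrite ?(ltW s0) ?mule_ge0 ?(pm x).1 ?lee_fin ?powR_ge0//.
    apply: lee_pmul; rewrite ?(pm x).1 ?lee_fin ?powR_ge0//; first exact: (pm x).2.
    exact: ler_npowR.
  have [tau /andP[t0tau taut1]] := integral_half_split t01 (mg _ _ (lexx _)) gM.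
  have G0 : 0 <= \int[@lebesgue_measure R]_(t in `[t0, t1]) g t.
    by apply: integral_ge0 => t /(sub _ _ (lexx _))/=; rewrite in_itv/= andbT; exact: g0.
  have Gfin : \int[@lebesgue_measure R]_(t in `[t0, t1]) g t \is a fin_num.
    rewrite ge0_fin_numE//; apply: (@le_lt_trans _ _ (\int[@lebesgue_measure R]_(t in `[t0, t1]) (cst M%:E) t)).
      apply: ge0_le_integral => //.
      - by move=> t /(sub _ _ (lexx _))/=; rewrite in_itv/= andbT; exact: g0.
      - exact: mg.
      - by move=> t /=; rewrite in_itv/= => /gM/andP[].
    rewrite integral_cst//= lebesgue_measure_itv/=.
    by case: ifPn => _; rewrite -?EFinD -?EFinM ?mule0 ltry.
  move: G0 Gfin; move: (\int[@lebesgue_measure R]_(t in `[t0, t1]) g t) => G G0 Gfin [h1 h2].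
  have hG0 : 0 <= 2^-1%:E * G by rewrite mule_ge0// lee_fin.
  pose a := (2 `^ (b * s) / 2)%R.
  have a0 : (0 < a)%R by rewrite divr_gt0// powR_gt0.
  have Wy y t : (0 < t)%R -> (t <= tau)%R -> eball x t y -> a%:E * G <= W y.
    move=> tp ttau yt.
    rewrite /W wolffE -/s -/b (@pot_scale _ b s 2%R _ _ (pm y))// /a EFinM -muleA.
    apply: lee_wpmul2l; first by rewrite lee_fin powR_ge0.
    apply: le_trans h2 _.
    have p2 := profile_scale (c := 2%R) (m := fun t => sigma (eball y t)) ltac:(by []) (pm y).
    apply: (@le_trans _ _ (\int[@lebesgue_measure R]_(u in `[tau, t1]) kern b s (fun u => sigma (eball y (2 * u)%R)) u)).
      apply: ge0_le_integral => //.
      - by move=> u /(sub _ _ t0tau)/=; rewrite in_itv/= andbT; exact: g0.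
      - exact: mg.
      - by apply: measurable_funS (sub _ _ t0tau) (mk _ p2).
      move=> u /[dup] /(sub _ _ t0tau)/=; rewrite !in_itv/= andbT => up /andP[tauu _].
      apply: kern_le => //; apply: le_measure; rewrite ?inE; [exact: measurable_eball..|].
      apply: subset_eball; rewrite enormB mulr_natl mulr2n lerD2r.
      by apply: ltW; apply: lt_le_trans yt _; exact: le_trans tauu.
    apply: ge0_subset_integral => //.
    - exact: mk.
    - by move=> u /=; rewrite in_itv/= andbT => up; exact: kern_ge0.
    - exact: sub.
  have aG0 : 0 <= a%:E * G by rewrite mule_ge0// lee_fin ltW.
  pose Gr := fine G.
  have GE : G = Gr%:E by rewrite fineK.
  have Gr0 : (0 <= Gr)%R by rewrite fine_ge0.
  have aGE : a%:E * G = (a * Gr)%:E by rewrite GE -EFinM.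
  have nuge t : (0 < t)%R -> (t <= tau)%R ->
      ((a * Gr) `^ r)%:E * sigma (eball x t) <= nu (eball x t).
    move=> tp ttau; rewrite -integral_cst; last exact: measurable_eball.
    apply: ge0_le_integral => //; first exact: measurable_eball.
    - by move=> y _; rewrite lee_fin powR_ge0.
    - by apply: measurable_funTS; exact: nWr.1.
    - move=> y yt; rewrite /= -(poweR_EFin (a * Gr)%R r) -aGE.
      by apply: le_poweR; [exact: ltW|exact: aG0|exact: Wy yt].
  apply: (@le_trans _ _ (\int[@lebesgue_measure R]_(t in `[t0, tau]) kern b s (fun t => nu (eball x t)) t)); last first.
    rewrite wolffE; apply: ge0_subset_integral => //; first exact: mk.
      by move=> u /=; rewrite in_itv/= andbT => up; exact: kern_ge0.
    exact: sub.
  apply: (@le_trans _ _ (\int[@lebesgue_measure R]_(t in `[t0, tau]) ((((a * Gr) `^ r) `^ s)%:E * g t))).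
    rewrite ge0_integralZl; [|exact: measurable_itv|exact: mg| |]; last 2 first.
    - by move=> t /(sub _ _ (lexx _))/=; rewrite in_itv/= andbT; exact: g0.
    - by rewrite lee_fin powR_ge0.
    apply: le_trans (lee_wpmul2l _ h1); last by rewrite lee_fin powR_ge0.
    rewrite GE poweR_EFin -!EFinM lee_fin le_eqVlt; apply/orP; left; apply/eqP.
    rewrite powRD; last by rewrite gt_eqF// addr_gt0.
    rewrite powRr1// -!powRrM powRM ?(ltW a0)// /c0 -/a -powRrM; ring.
  apply: ge0_le_integral => //.
  - by move=> t /(sub _ _ (lexx _))/=; rewrite in_itv/= andbT => tp;
      apply: mule_ge0; [rewrite lee_fin powR_ge0|exact: g0].
  - by apply: measurable_funeM; exact: mg.
  - by apply: measurable_funS (sub _ _ (lexx _)) (mk _ pnu).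
  move=> t /[dup] /(sub _ _ (lexx _))/=; rewrite !in_itv/= andbT => tp /andP[_ ttau].
  have -> : (((a * Gr) `^ r) `^ s)%:E * g t = kern b s (fun t => ((a * Gr) `^ r)%:E * sigma (eball x t)) t.
    rewrite /g /kern -(muleA _ (sigma _)) (@poweRM _ ((a * Gr) `^ r)%:E) ?lee_fin ?powR_ge0//.
      by rewrite muleA.
    by rewrite mule_ge0 ?(pm x).1// lee_fin powR_ge0.
  apply: kern_le => //; first by rewrite mule_ge0 ?(pm x).1// lee_fin powR_ge0.
  exact: nuge.
pose F (k : nat) : set (measurableTypeR R) := `[(k.+1%:R^-1)%R, (k.+1%:R)%R]%classic.
have FU : `]0%R, +oo[%classic = \bigcup_k F k.
  apply/seteqP; split=> t /=; last first.
    by move=> [k _]; rewrite /F/= !in_itv/= andbT => /andP[h _]; apply: lt_le_trans h; rewrite invr_gt0.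
  rewrite in_itv/= andbT => t0.
  pose k := maxn (Num.bound t) (Num.bound t^-1).
  exists k => //; rewrite /F/= in_itv/=.
  have h1 : (t <= k.+1%:R)%R.
    apply: le_trans (ltW (archi_boundP (ltW t0))) _; rewrite ler_nat.
    by rewrite (leq_trans (leq_maxl _ (Num.bound t^-1)))// leqnSn.
  have h2 : (t^-1 <= k.+1%:R)%R.
    apply: le_trans (ltW (archi_boundP _)) _; first by rewrite invr_ge0 ltW.
    by rewrite ler_nat (leq_trans (leq_maxr (Num.bound t) _))// leqnSn.
  by rewrite h1 andbT -[leRHS]invrK lef_pV2 ?posrE ?invr_gt0.
have ndF : nondecreasing_seq F.
  move=> j k jk; apply/subsetPset => t; rewrite /F/= !in_itv/= => /andP[h1 h2].
  rewrite (le_trans h2) ?ler_nat// andbT; apply: le_trans h1.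
  by rewrite lef_pV2 ?posrE ?ltr0n// ler_nat.
have mF k : measurable (F k) by exact: measurable_itv.
have subF k : F k `<=` `]0%R, +oo[%classic by rewrite FU; exact: bigcup_sup.
have mgF k : measurable_fun (F k) g by apply: measurable_funS (@subF k) (mk _ (pm x)).
have g0F k t : F k t -> 0 <= g t.
  by move=> /subF/=; rewrite in_itv/= andbT; exact: kern_ge0.
have nd := ge0_nondecreasing_set_nondecreasing_integral (@lebesgue_measure R) ndF mF mgF g0F.
have /cvg_lim lim1 := ge0_nondecreasing_set_cvg_integral (mu := @lebesgue_measure R) ndF mF mgF g0F.
have /cvg_lim lim2 := ereal_nondecreasing_cvgn nd.
rewrite wolffE -/s -/b /pot -/g FU -lim1// lim2//.
rewrite poweR_sup; last 2 first.
- by rewrite addr_gt0.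
- by move=> k; apply: integral_ge0 => t; exact: g0F.
rewrite -ereal_supM_seq; last by rewrite divr_ge0 ?(ltW c00).
apply: ge_ereal_sup => _ [k _ <-]; apply: key; first by rewrite invr_gt0.
by rewrite (@le_trans _ _ 1%R) ?invf_le1 ?ler1n.
Qed.

End lower_bound.

(** * The sublinear equation *)

Lemma ae_leb_mono (R : realType) (n : nat) (P Q : Rn R n -> Prop) :
  (forall x, P x -> Q x) -> ae_leb P -> ae_leb Q.
Proof.
move=> PQ aeP eps /aeP[a [b [ab [Pab abe]]]]; exists a, b; split=> //; split=> //.
by move=> x nQx; apply: Pab => /PQ.
Qed.

Section sublinear_iteration.
Context {R : realType} {n : nat} (alpha p q : R).
Context (sigma : {measure set (Rn R n) -> \bar R}).
Hypotheses (p1 : 1 < p) (q0 : 0 < q) (qp : q < p - 1).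
Local Open Scope ereal_scope.
Implicit Types x y : Rn R n.

Let s := (1 / (p - 1))%R.
Let g := ((p - 1) / (p - 1 - q))%R.
Let r := ((p - 1) * q / (p - 1 - q))%R.
Let w := wolff alpha p sigma.
Let Wr := wolff alpha p (dens_measure (fun y => poweR (w y) r) sigma).
Let T (f : Rn R n -> \bar R) := wolff alpha p (dens_measure (fun y => poweR (f y) q) sigma).

Let pm1 : (0 < p - 1)%R. Proof. by rewrite subr_gt0. Qed.
Let pq0 : (0 < p - 1 - q)%R. Proof. by rewrite subr_gt0. Qed.
Let s0 : (0 < s)%R. Proof. by rewrite divr_gt0. Qed.
Let g0 : (0 < g)%R. Proof. by rewrite divr_gt0. Qed.
Let r0 : (0 < r)%R. Proof. by rewrite divr_gt0 ?mulr_gt0. Qed.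
Let qs1 : (0 < 1 - q * s)%R.
Proof. by rewrite subr_gt0 /s mulrA mulr1 ltr_pdivrMr// mul1r. Qed.
Let rE : r = (g * q)%R. Proof. by rewrite /r /g mulrAC. Qed.
Let gE : (r * s + 1 = g)%R.
Proof. by rewrite /r /s /g; field; rewrite !gt_eqF. Qed.

Let w0 x : 0 <= w x. Proof. exact: wolff_ge0. Qed.
Let nw : nnegmeas w. Proof. exact: wolff_sigma_nnegmeas. Qed.
Let nwr : nnegmeas (fun y => poweR (w y) r). Proof. exact: nnegmeas_poweR. Qed.

Let wrE y : poweR (w y) r = poweR (poweR (w y) g) q.
Proof. by rewrite rE poweRrM. Qed.

Let T_nnegmeas f : nnegmeas f -> nnegmeas (T f).
Proof. by move=> nf; apply: wolff_nnegmeas => //; exact: nnegmeas_poweR. Qed.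

Let T_le f h : nnegmeas f -> nnegmeas h -> (forall y, f y <= h y) ->
  forall x, T f x <= T h x.
Proof.
move=> nf nh fh x; apply: wolff_le => //; [exact: nnegmeas_poweR..|].
by move=> y; apply: le_poweR => //; [exact: ltW|exact: nf.2].
Qed.

(** As [r = g q], the lower bound on [u] gives [w^r = (w^g)^q <= c^q u^q]; a constant factor of the
    measure leaves the potential with power [s]. *)
Lemma wolff_power_le_supersolution (c : R) (u : Rn R n -> \bar R) : (0 < c)%R ->
  nnegmeas u -> (forall x, c^-1%:E * poweR (w x) g <= u x) ->
  forall x, Wr x <= ((c `^ q) `^ s)%:E * T u x.
Proof.
move=> c0 nu wu x.
have nuq := nnegmeas_poweR q nu.
rewrite /T -(wolff_cmul sigma alpha p x (powR_ge0 c q) nuq).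
apply: wolff_le; [exact: p1|exact: nwr|exact: nnegmeas_cmul (powR_ge0 c q) nuq|].
move=> y; rewrite wrE -poweR_EFin -poweRM ?lee_fin ?(ltW c0) ?nu.2//.
apply: le_poweR; [exact: ltW|exact: poweR_ge0|].
have -> : poweR (w y) g = c%:E * (c^-1%:E * poweR (w y) g).
  by rewrite muleA -EFinM mulfV ?mul1e// gt_eqF.
by apply: lee_wpmul2l => //; rewrite lee_fin ltW.
Qed.

Lemma sublinear_solution (K kappa : R) : (0 < K)%R -> (0 <= kappa)%R ->
  (forall x, K%:E * poweR (w x) g <= Wr x) ->
  (forall x, Wr x <= kappa%:E * (w x + poweR (w x) g)) ->
  let c0 := (K `^ (1 - q * s)^-1)%R in
  let c1 := Num.max c0 ((4 `^ q `^ s * 2 `^ s * (1 + kappa)) `^ (1 - q * s)^-1)%R in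
  exists u : Rn R n -> \bar R, [/\ nnegmeas u, forall x, u x = T u x,
    forall x, c0%:E * poweR (w x) g <= u x &
    forall x, u x <= c1%:E * (w x + poweR (w x) g)].
Proof.
move=> K0 k0 lowW upW c0 c1.
(* [B] collects the losses of one step: [4^q], raised to [s], from
   [(2 (1 + w^g))^q <= 4^q (1 + w^r)]; [2^s] from splitting the potential of a sum; [1 + kappa] from
   [w + Wr <= (1 + kappa)(w + w^g)]. *)
pose B := (4 `^ q `^ s * 2 `^ s * (1 + kappa))%R.
have B0 : (0 < B)%R by rewrite !mulr_gt0 ?powR_gt0// ltr_pwDl.
have c00 : (0 < c0)%R by exact: powR_gt0.
have c01 : (c0 <= c1)%R by rewrite /c1 le_max lexx.
have c10 : (0 < c1)%R := lt_le_trans c00 c01.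
(* [c0] and [c1] balance the scaling exponent [q s < 1] of [T]. *)
have c0E : (c0 `^ q `^ s * K = c0)%R.
  rewrite -powRrM /c0 -powRrM -[X in (_ * X = _)%R]powRr1 ?(ltW K0)// -powRD.
    by congr powR; field; rewrite gt_eqF.
  by rewrite (gt_eqF K0) implybT.
have c1B : (c1 `^ q `^ s * B <= c1)%R.
  rewrite -powRrM -[leRHS]powRr1 ?(ltW c10)// -[X in (_ <= _ `^ X)%R](subrKC (q * s)%R) powRD; last first.
    by rewrite (gt_eqF c10) implybT.
  apply: ler_wpM2l; first exact: powR_ge0.
  rewrite -[leLHS](powRr1 (ltW B0)) -[X in (_ `^ X <= _)%R](@mulVf _ (1 - q * s)%R) ?gt_eqF// powRrM.
  apply: ge0_ler_powR; rewrite ?nnegrE ?powR_ge0 ?(ltW qs1) ?(ltW c10)//.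
  by rewrite /c1 le_max lexx orbT.
pose u := fix u (k : nat) : Rn R n -> \bar R :=
  if k is k'.+1 then T (u k') else fun x => c0%:E * poweR (w x) g.
have nu k : nnegmeas (u k).
  by elim: k => [|k IH]; [apply: nnegmeas_cmul (ltW c00) _; exact: nnegmeas_poweR|exact: T_nnegmeas].
have u01 x : u 0%N x <= u 1%N x.
  have -> : u 1%N x = ((c0 `^ q) `^ s)%:E * Wr x.
    have e : (fun y => poweR (u 0%N y) q) = (fun y => (c0 `^ q)%:E * poweR (w y) r).
      apply/funext => y; rewrite wrE /= poweRM ?lee_fin ?(ltW c00)//.
      exact: poweR_ge0.
    rewrite -[LHS]/(wolff alpha p (dens_measure (fun y => poweR (u 0%N y) q) sigma) x) e.
    exact: wolff_cmul (powR_ge0 c0 q) nwr.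
  rewrite /= -{1}c0E EFinM -muleA; apply: lee_wpmul2l; [by rewrite lee_fin powR_ge0|exact: lowW].
have uS k x : u k x <= u k.+1 x.
  elim: k x => [|k IH] x; first exact: u01.
  exact: T_le (nu k) (nu k.+1) IH x.
have ndu x : {homo u^~ x : j k / (j <= k)%N >-> j <= k}.
  by apply/nondecreasing_seqP => k; exact: uS.
have uub k x : u k x <= c1%:E * (w x + poweR (w x) g).
  elim: k x => [|k IH] x.
    apply: lee_pmul; [by rewrite lee_fin ltW|exact: poweR_ge0|by rewrite lee_fin|].
    by rewrite leeDr// w0.
  have nwr1 : nnegmeas (fun y => 1 + poweR (w y) r).
    by apply: nnegmeas_add => //; exact: nnegmeas_cst.
  (* Since [g >= 1], [w <= 1 + w^g]. Trading [w] for the constant 1 is what closes the induction: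
     the density 1 has potential [w], and [w^r] has potential [Wr]. *)
  have pt y : poweR (u k y) q <= (c1 `^ q * 4 `^ q)%:E * (1 + poweR (w y) r).
    apply: (@le_trans _ _ (poweR ((c1 * 2)%:E * (1 + poweR (w y) g)) q)).
      apply: le_poweR; [exact: ltW|exact: (nu k).2|].
      apply: le_trans (IH y) _; rewrite EFinM -muleA; apply: lee_wpmul2l; first by rewrite lee_fin ltW.
      rewrite mule_natl mule2n; apply: leeD.
        have [w1|w1] := leP (w y) 1.
          by apply: le_trans w1 _; rewrite leeDl// poweR_ge0.
        apply: (@le_trans _ _ (poweR (w y) g)); last by rewrite leeDr.
        rewrite -[leLHS]poweRe1//.
        case: (w y) w1 => [v| |]//; rewrite ?poweRyr ?gt_eqF ?leey//.
        rewrite lte_fin !poweR_EFin lee_fin => v1; apply: ler_powR; first exact: ltW.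
        by rewrite /g ler_pdivlMr// mul1r gerBl ltW.
      by rewrite leeDr.
    have wg1 : 0 <= 1 + poweR (w y) g by rewrite adde_ge0 ?poweR_ge0.
    rewrite poweRM ?lee_fin ?mulr_ge0 ?(ltW c10)// poweR_EFin powRM ?(ltW c10)//.
    rewrite (_ : 4 = 2 * 2 :> R)%R; last by ring.
    rewrite (@powRM _ 2 2)// mulrA.
    rewrite [X in _ <= X * _]EFinM -[leRHS]muleA.
    apply: lee_wpmul2l; first by rewrite lee_fin mulr_ge0 ?powR_ge0.
    apply: le_trans (poweRD_le _ _ _) _; rewrite ?poweR_ge0 ?(ltW q0)//.
    by rewrite poweR1r wrE.
  apply: (@le_trans _ _ (((c1 `^ q * 4 `^ q) `^ s)%:E *
      wolff alpha p (dens_measure (fun y => 1 + poweR (w y) r) sigma) x)).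
    have c40 : (0 <= c1 `^ q * 4 `^ q)%R by rewrite mulr_ge0 ?powR_ge0.
    rewrite -(wolff_cmul sigma alpha p x c40 nwr1).
    apply: wolff_le; [exact: p1|exact: nnegmeas_poweR|exact: nnegmeas_cmul|exact: pt].
  have n1 : nnegmeas (fun _ : Rn R n => 1 : \bar R) by exact: nnegmeas_cst.
  have add1 := wolff_add sigma alpha p1 x n1 nwr.
  rewrite wolff_dens1 -/w -/Wr in add1.
  apply: (@le_trans _ _ (((c1 `^ q * 4 `^ q) `^ s)%:E * ((2 `^ s)%:E * (w x + Wr x)))).
    by apply: lee_wpmul2l; [rewrite lee_fin powR_ge0|exact: add1].
  rewrite muleA -EFinM.
  have E0 : 0 <= w x + poweR (w x) g by rewrite adde_ge0 ?poweR_ge0.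
  apply: (@le_trans _ _ ((c1 `^ q `^ s * B)%:E * (w x + poweR (w x) g))); last first.
    by apply: lee_wpmul2r => //; rewrite lee_fin.
  have -> : (c1 `^ q `^ s * B = (c1 `^ q * 4 `^ q) `^ s * 2 `^ s * (1 + kappa))%R.
    by rewrite (@powRM _ (c1 `^ q)%R) ?powR_ge0// /B !mulrA.
  rewrite [X in _ <= X * _]EFinM -[leRHS]muleA.
  apply: lee_wpmul2l; first by rewrite lee_fin mulr_ge0 ?powR_ge0.
  rewrite EFinD ge0_muleDl ?lee_fin// mul1e; apply: leeD; last exact: upW.
  by rewrite leeDl ?poweR_ge0.
pose v x := ereal_sup (range (u^~ x)).
have nv : nnegmeas v by exact: nnegmeas_sup.
have uv k x : u k x <= v x by apply: ereal_sup_ubound; exists k.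
exists v; split=> //.
- move=> x; rewrite /T.
  have -> : (fun y => poweR (v y) q) = (fun y => ereal_sup (range (fun k => poweR (u k y) q))).
    by apply/funext => y; rewrite poweR_sup// => k; exact: (nu k).2.
  rewrite (@wolff_sup _ _ _ _ _ _ (fun k y => poweR (u k y) q))//; last 2 first.
  - by move=> k; exact: nnegmeas_poweR.
  - move=> y j k jk; apply: le_poweR; [exact: ltW|exact: (nu j).2|exact: ndu].
  (* Both sides are suprema of the same increasing sequence, with indices shifted by one. *)
  apply/eqP; rewrite eq_le; apply/andP; split; apply: ge_ereal_sup => _ [k _ <-].
    by apply: le_trans (uS k x) _; apply: ereal_sup_ubound; exists k.
  exact: (uv k.+1).
- by move=> x; exact: (uv 0%N).
- by move=> x; apply: ge_ereal_sup => _ [k _ <-]; exact: uub.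
Qed.

End sublinear_iteration.


(** * From almost everywhere to everywhere *)

Section dagger.
Context {R : realType} {n : nat} (alpha p q kappa C : R).
Hypotheses (p1 : 1 < p) (qp : q < p - 1).
Hypotheses (kappa0 : 0 < kappa) (C0 : 0 < C).
Context (sigma : {measure set (Rn R n) -> \bar R}).
Local Open Scope ereal_scope.

(** If the bound failed at [x], semicontinuity would make the left side exceed the fixed right-hand
    value on a whole neighbourhood. A good point [y] there contradicts this: [w y] costs a factor
    [C] and its power a factor [C^g], both covered by [C + C^g]. *)
Lemma dagger_everywhere :
  (forall (N : set (Rn R n)) (x : Rn R n) (delta : R),
    lebesgue_null N -> (0 < delta)%R ->
    exists y : Rn R n, [/\ ~ N y, (enorm (y - x : 'rV[R]_n) < delta)%R &
    wolff alpha p sigma y <= C%:E * wolff alpha p sigma x]) ->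
  ae_leb (fun x =>
    wolff alpha p (dens_measure (fun y => poweR (wolff alpha p sigma y)
                                    ((p - 1) * q / (p - 1 - q))) sigma) x
    <= kappa%:E * (wolff alpha p sigma x
                   + poweR (wolff alpha p sigma x) ((p - 1) / (p - 1 - q)))) ->
  forall x, wolff alpha p (dens_measure (fun y => poweR (wolff alpha p sigma y)
                                    ((p - 1) * q / (p - 1 - q))) sigma) x
    <= (kappa * (C + C `^ ((p - 1) / (p - 1 - q))))%:E * (wolff alpha p sigma x
                   + poweR (wolff alpha p sigma x) ((p - 1) / (p - 1 - q))).
Proof.
set r := ((p - 1) * q / (p - 1 - q))%R; set g := ((p - 1) / (p - 1 - q))%R.
have g0 : (0 < g)%R by rewrite divr_gt0 ?subr_gt0.
move=> gp aeP x; rewrite leNgt; apply/negP => lt1.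
have nw := @wolff_sigma_nnegmeas _ _ sigma alpha _ p1.
have [d d0 dP] := wolff_lsc p1 (nnegmeas_poweR r nw) lt1.
have [y [/contrapT yP yx yw]] := gp _ x d aeP d0.
have := dP y yx; apply/negP; rewrite -leNgt; apply: le_trans yP _.
rewrite EFinM -muleA; apply: lee_wpmul2l; first by rewrite lee_fin ltW.
have w0 z : 0 <= wolff alpha p sigma z by exact: wolff_ge0.
have Cg0 : (0 <= C `^ g)%R by exact: powR_ge0.
move: (wolff alpha p sigma x) (wolff alpha p sigma y) (w0 x) (w0 y) yw => a c a0 c0 ca.
have h : poweR c g <= (C `^ g)%:E * poweR a g.
  rewrite -poweR_EFin -poweRM ?lee_fin ?(ltW C0)//.
  by apply: le_poweR => //; exact: ltW.
have ag0 : 0 <= poweR a g by exact: poweR_ge0.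
rewrite EFinD ge0_muleDl ?lee_fin ?(ltW C0)// !ge0_muleDr//.
apply: le_trans (leeD ca h) _; apply: leeD; [rewrite leeDl//|rewrite leeDr//].
- by rewrite mule_ge0// lee_fin ltW.
- by rewrite mule_ge0// lee_fin.
Qed.

End dagger.

Theorem theorem3p3 (R : realType) :
  (* existence of a solution under (dagger); c = c(alpha, n, p, q, kappa) *)
  (forall (n : nat) (alpha p q kappa : R),
    1 < p -> 0 < q -> q < p - 1 -> 0 < alpha -> alpha < n%:R / p -> 0 < kappa ->
    exists c : R, 0 < c /\
    forall sigma : {measure set (Rn R n) -> \bar R},
      locally_finite_measure sigma ->
      ae_leb (fun x =>
        (wolff alpha p
           (dens_measure (fun y => poweR (wolff alpha p sigma y)
                                    ((p - 1) * q / (p - 1 - q))) sigma) x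
         <= kappa%:E * (wolff alpha p sigma x
                        + poweR (wolff alpha p sigma x) ((p - 1) / (p - 1 - q)))
         /\ kappa%:E * (wolff alpha p sigma x
                        + poweR (wolff alpha p sigma x) ((p - 1) / (p - 1 - q)))
            < +oo)%E) ->
      exists u : Rn R n -> \bar R,
        (forall x, 0 <= u x)%E /\
        measurable_fun [set: Rn R n] u /\
        (forall (x : Rn R n) (r : R),
            (\int[sigma]_(y in eball x r) poweR (u y) q < +oo)%E) /\
        (forall x, u x = wolff alpha p (dens_measure (fun y => poweR (u y) q) sigma) x) /\
        (forall x,
           (c^-1%:E * poweR (wolff alpha p sigma x) ((p - 1) / (p - 1 - q)) <= u x)%E /\
           (u x <= c%:E * (wolff alpha p sigma x
                    + poweR (wolff alpha p sigma x) ((p - 1) / (p - 1 - q))))%E))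
  /\
  (* converse: supersolutions satisfying (double dagger) force (dagger);
     kappa = kappa(p, q, c) *)
  (forall (p q c : R),
    1 < p -> 0 < q -> q < p - 1 -> 0 < c ->
    exists kappa : R, 0 < kappa /\
    forall (n : nat) (alpha : R), 0 < alpha -> alpha < n%:R / p ->
    forall (sigma : {measure set (Rn R n) -> \bar R}) (u : Rn R n -> \bar R),
      locally_finite_measure sigma ->
      measurable_fun [set: Rn R n] u ->
      (forall x, 0 <= u x)%E ->
      (exists x, u x != 0%E) ->
      ae_leb (fun x => u x < +oo)%E ->
      (forall x, wolff alpha p (dens_measure (fun y => poweR (u y) q) sigma) x <= u x)%E ->
      (forall x,
         (c^-1%:E * poweR (wolff alpha p sigma x) ((p - 1) / (p - 1 - q)) <= u x)%E /\
         (u x <= c%:E * (wolff alpha p sigma x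
                  + poweR (wolff alpha p sigma x) ((p - 1) / (p - 1 - q))))%E) ->
      ae_leb (fun x =>
        (wolff alpha p
           (dens_measure (fun y => poweR (wolff alpha p sigma y)
                                    ((p - 1) * q / (p - 1 - q))) sigma) x
         <= kappa%:E * (wolff alpha p sigma x
                        + poweR (wolff alpha p sigma x) ((p - 1) / (p - 1 - q)))
         /\ kappa%:E * (wolff alpha p sigma x
                        + poweR (wolff alpha p sigma x) ((p - 1) / (p - 1 - q)))
            < +oo)%E)).
Proof.
split.
- move=> n alpha p q kappa p1 q0 qp alpha0 alphan kappa0.
  have pq0 : 0 < p - 1 - q by rewrite subr_gt0.
  have pm1 : 0 < p - 1 by rewrite subr_gt0.
  set g := (p - 1) / (p - 1 - q); set r := (p - 1) * q / (p - 1 - q).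
  have r0 : 0 < r by rewrite divr_gt0 ?mulr_gt0.
  have rg : r * (1 / (p - 1)) + 1 = g by rewrite /r /g; field; rewrite !gt_eqF.
  (* [C] and [K] are obtained before [sigma] is introduced, so [c] does not depend on the
     measure. *)
  have [C C0 gp] := wolff_good_point p1 alpha0 alphan.
  have [K K0 lowW] := wolff_iter_ge p1 alphan r0.
  rewrite rg in lowW.
  pose kappa' := kappa * (C + C `^ g).
  have kappa'0 : 0 < kappa' by rewrite mulr_gt0// addr_gt0// powR_gt0.
  pose c0 := K `^ (1 - q * (1 / (p - 1)))^-1.
  pose c1 := Num.max c0 ((4 `^ q `^ (1 / (p - 1)) * 2 `^ (1 / (p - 1)) * (1 + kappa')) `^ (1 - q * (1 / (p - 1)))^-1).
  have c00 : 0 < c0 by exact: powR_gt0.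
  have c10 : 0 < c1 by rewrite lt_max c00.
  (* One constant for both sides: [c1 <= c] for the upper bound, [c^-1 <= c0] for the lower one. *)
  pose c := Num.max c1 c0^-1.
  have c_gt0 : 0 < c by rewrite lt_max c10.
  exists c; split=> // sigma lfs dagger.
  have gps N x d : lebesgue_null N -> 0 < d -> _ := gp sigma N x d lfs.
  have upW := dagger_everywhere p1 qp kappa0 C0 gps (ae_leb_mono (fun x => @proj1 _ _) dagger).
  have [u [nu uE ulow uup]] := sublinear_solution p1 q0 qp K0 (ltW kappa'0)
    (fun x => lowW sigma x lfs) upW.
  exists u; split; first exact: nu.2.
  split; first exact: nu.1.
  have w0 x : (0 <= wolff alpha p sigma x)%E by exact: wolff_ge0.
  split; last first.
    split=> // x; split.
      apply: le_trans (ulow x); apply: lee_wpmul2r; first exact: poweR_ge0.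
      by rewrite lee_fin -[leRHS]invrK lef_pV2 ?posrE ?invr_gt0// le_max lexx orbT.
    apply: le_trans (uup x) _; apply: lee_wpmul2r; first by rewrite adde_ge0 ?poweR_ge0.
    by rewrite lee_fin le_max lexx.
  move=> x t.
  (* Any [y] outside the exceptional set will do: there [w + w^g] is finite, so [u y] is, and [u y]
     is a potential of [u^q dsigma]. Every ball [B(x,t)] lies in a ball centred at [y], whose mass
     is then finite. *)
  have [y [/contrapT[_ yfin] _ _]] := gps _ x 1 dagger ltr01.
  have uy : (u y < +oo)%E.
    apply: le_lt_trans (uup y) _; move: yfin.
    have : (0 <= wolff alpha p sigma y + poweR (wolff alpha p sigma y) g)%E.
      by rewrite adde_ge0 ?poweR_ge0.
    move: (_ + _)%E => [e| |]//; first by move=> _ _; rewrite -EFinM ltry.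
    by move=> _; rewrite gt0_muley ?lte_fin// ltxx.
  have nuq := nnegmeas_poweR q nu.
  rewrite uE wolffE in uy.
  have b0 : alpha * p - n%:R <= 0 by rewrite subr_le0 -ler_pdivlMr ?(lt_trans ltr01 p1)// ltW.
  have s0 : 0 < 1 / (p - 1) by rewrite divr_gt0.
  have := pot_lty s0 (enorm (x - y : 'rV[R]_n) + t) b0 (dens_profile sigma y nuq) uy.
  apply: le_lt_trans; apply: dens_subset => //; [exact: measurable_eball..|].
  exact: subset_eball.
- move=> p q c p1 q0 qp c0.
  have pq0 : 0 < p - 1 - q by rewrite subr_gt0.
  have g0 : 0 < (p - 1) / (p - 1 - q) by rewrite divr_gt0 ?subr_gt0.
  (* [c^(q s)] comes from replacing [w^g] by [c u] under the potential, the last [c] from the upper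
     bound on [u]. *)
  pose kappa := (c `^ q) `^ (1 / (p - 1)) * c.
  exists kappa; split; first by rewrite mulr_gt0 ?powR_gt0.
  move=> n alpha alpha0 alphan sigma u lfs mu u0 _ ufin usup ubnd.
  apply: ae_leb_mono ufin => x ux.
  have [lowu upu] := ubnd x.
  split.
    have nu : nnegmeas u by [].
    have h := wolff_power_le_supersolution p1 q0 c0 nu (fun x => (ubnd x).1) x.
    apply: le_trans h _; rewrite /kappa EFinM -muleA.
    apply: lee_wpmul2l; first by rewrite lee_fin powR_ge0.
    exact: le_trans (usup x) upu.
  (* Finiteness of [w] is inherited from [u] through the lower bound [c^-1 w^g <= u]. *)
  have wg : (poweR (wolff alpha p sigma x) ((p - 1) / (p - 1 - q)) < +oo)%E.
    rewrite ltey; apply/eqP => wy; move: lowu; rewrite wy gt0_muley ?lte_fin ?invr_gt0//.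
    by rewrite leye_eq => /eqP uy; rewrite uy ltxx in ux.
  have w1 := lty_poweRy (lt0r_neq0 g0) wg.
  have w0 : (0 <= wolff alpha p sigma x)%E by exact: wolff_ge0.
  have wfin : wolff alpha p sigma x \is a fin_num by rewrite ge0_fin_numE.
  by rewrite -(fineK wfin) poweR_EFin -EFinD -EFinM ltry.
Qed.
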